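(* Let $\mathcal F$ be a collection of symmetric measurable functions $f:S^r\to\mathbb R$ with a measurable envelope $F:S^r\to[0,\infty)$ such that $0<P^rF^2<\infty$. Let $M\ge1$ and $0<N\le|I_{n,r}|$ be integers, $p_n=N/|I_{n,r}|$, and let $\{Z_\iota^{(m)}:\iota\in I_{n,r},m\in[M]\}$ be i.i.d. Bernoulli$(p_n)$ random variables independent of the data $X_1,\dots,X_n$. For $m\in[M]$ and $f\in\mathcal F$ let $\mathbb D_n^{(m)}(f):=N^{-1/2}\sum_{\iota\in I_{n,r}}(Z_\iota^{(m)}-p_n)f(X_\iota)$, and let $\widetilde{\mathcal T}:=\max_{\iota\in I_{n,r},m\in[M]}Z_\iota^{(m)}F(X_\iota)$. Then for some absolute constant $C>0$, $$\mathbb E\Big[\max_{m\in[M]}\|\mathbb D_n^{(m)}(f)\|_{\mathcal F}^2\Big]\le C\,\bar J^2(1)\left(\log(2M)\|F\|_{P^r,2}^2+\frac{\log^2(2M)\|\widetilde{\mathcal T}\|_{\mathbb P,2}^2}{N}\right).$$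
   Context: $r\ge2$; $(S,\mathcal S)$ is a measurable space; $X_1,\dots,X_n$ are i.i.d. $S$-valued with law $P$; $I_{n,r}=\{(i_1,\dots,i_r):1\le i_1<\dots<i_r\le n\}$, $X_\iota=(X_{i_1},\dots,X_{i_r})$. $F$ is an envelope of $\mathcal F$ if $F\ge\sup_{f\in\mathcal F}|f|$ pointwise. $\|\cdot\|_{\mathcal F}=\sup_{f\in\mathcal F}|\cdot|$; $\|F\|_{P^r,2}=(\mathbb E F(X_1,\dots,X_r)^2)^{1/2}$; $\|\widetilde{\mathcal T}\|_{\mathbb P,2}=(\mathbb E\widetilde{\mathcal T}^2)^{1/2}$. $\bar J(\tau)=\int_0^\tau\sqrt{1+\sup_Q\log N(\mathcal F,\|\cdot\|_{Q,2},\epsilon\|F\|_{Q,2})}\,d\epsilon$, with $\sup_Q$ over finitely supported probability measures on $S^r$, $\|\cdot\|_{Q,2}$ the $L^2(Q)$ seminorm, and $N(T,d,\epsilon)$ the $\epsilon$-covering number (minimal number of closed $d$-balls of radius $\epsilon$ covering $T$).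
   Formalization: It is also assumed that, for every fixed 0/1 value of the selection variables, the supremum of |D_n(f)| over the class is a measurable function of the data on S^n; for uncountable classes the expectation on the left is otherwise undefined. *)

(* Defs.v *)
From HB Require Import structures.
From mathcomp Require Import all_boot all_order all_algebra perm.
From mathcomp Require Import all_classical all_reals all_analysis.
From mathcomp Require Import measurable_realfun.

Set Implicit Arguments.
Unset Strict Implicit.
Unset Printing Implicit Defensive.

Import Order.TTheory GRing.Theory Num.Theory.
Import numFieldNormedType.Exports.

Local Open Scope classical_set_scope.
Local Open Scope ring_scope.

Definition tuple_of_pair {S : Type} {k : nat} (x : S * k.-tuple S) :
    k.+1.-tuple S :=
  [tuple of x.1 :: x.2].

Lemma measurable_tuple_of_pair d (S : measurableType d) (k : nat) :
  measurable_fun [set: S * k.-tuple S] (@tuple_of_pair S k).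
Proof. exact: measurable_cons. Qed.

HB.instance Definition _ d (S : measurableType d) (k : nat) :=
  isMeasurableFun.Build _ _ _ _ (@tuple_of_pair S k)
    (@measurable_tuple_of_pair d S k).

(* The product measure P^k on S^k, by P^0 = the point mass at the empty tuple
   and P^(k+1) = the image of P x P^k under the identification
   S x S^k = S^(k+1). *)
Fixpoint power_probability d (S : measurableType d) (R : realType)
    (P : probability S R) (k : nat) : probability (k.-tuple S) R :=
  match k with
  | 0 => \d_([tuple] : 0.-tuple S)
  | k'.+1 => distribution (P \x power_probability P k')%E
               (@tuple_of_pair S k')
  end.

Definition symmetric_fun (S T : Type) (r : nat) (f : r.-tuple S -> T) : Prop :=
  forall (s : 'S_r) (x : r.-tuple S), f [tuple tnth x (s i) | i < r] = f x.

(* sup over f in FF of |phi f|, in [0, +oo]; the 0 only matters when FF is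
   empty, where it makes the supremum 0 rather than -oo. *)
Definition sup_norm (T : Type) (R : realType) (FF : set T) (phi : T -> R) :
    \bar R :=
  ereal_sup (0%E |` [set `|phi f|%:E | f in FF]).

(* I_{n,r}, indexed from 0. *)
Definition index_set (n r : nat) : finType :=
  {t : r.-tuple 'I_n | sorted ltn [seq val i | i <- t]}.

Definition subsample (S : Type) (n r : nat) (x : n.-tuple S)
    (t : index_set n r) : r.-tuple S :=
  [tuple tnth x (tnth (val t) k) | k < r].

Section independence.
Context d (Omega : measurableType d) (R : realType) (Pr : probability Omega R).

(* As the sets A i may be the whole space, the product rule over all of the
   finite set I contains the product rule over each of its subsets. *)
Definition mutually_independent (I : finType) d' (T : measurableType d')
    (X : I -> {RV Pr >-> T}) : Prop :=
  forall A : I -> set T, (forall i, measurable (A i)) ->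
    Pr (\bigcap_(i in [set: I]) X i @^-1` A i) =
    (\prod_(i : I) Pr (X i @^-1` A i))%E.

Definition sigma_generated (I : Type) d' (T : measurableType d')
    (X : I -> {RV Pr >-> T}) : set (set Omega) :=
  <<s [set E | exists i, exists2 A, measurable A & E = X i @^-1` A] >>.

Definition independent_families (I J : Type) d1 (T1 : measurableType d1)
    d2 (T2 : measurableType d2)
    (X : I -> {RV Pr >-> T1}) (Y : J -> {RV Pr >-> T2}) : Prop :=
  forall A B, sigma_generated X A -> sigma_generated Y B ->
    Pr (A `&` B) = (Pr A * Pr B)%E.

End independence.

Section entropy.
Context d (T : measurableType d) (R : realType).

(* Q is a finite combination of point masses; its weights sum to 1 because Q
   is a probability. *)
Definition finitely_supported (Q : probability T R) : Prop :=
  exists (k : nat) (x : 'I_k -> T) (w : 'I_k -> R),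
    (forall i, 0 <= w i) /\
    forall A, measurable A -> Q A = (\sum_(i < k) (w i)%:E * \d_(x i) A)%E.

(* Minimal number of closed balls of radius eps, centred in A, which cover A;
   it is +oo if there is no finite cover. *)
Definition covering_number (U : Type) (dist : U -> U -> \bar R) (A : set U)
    (eps : \bar R) : \bar R :=
  ereal_inf [set (k%:R : R)%:E | k in [set k | exists c : 'I_k -> U,
    (forall i, A (c i)) /\
    forall f, A f -> exists i, (dist (c i) f <= eps)%E]].

Definition L2 (mu : {measure set T -> \bar R}) (f : T -> R) : \bar R :=
  ('N[mu]_2%:E[EFin \o f])%E.

Definition entropy_integral (FF : set (T -> R)) (F : T -> R) (tau : R) :
    \bar R :=
  (\int[lebesgue_measure]_(eps in `[0%R, tau])
    sqrte (1 + ereal_sup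
      [set lne (covering_number (fun f g => L2 Q (fun x => f x - g x)%R) FF
                  (eps%:E * L2 Q F))
      | Q in [set Q : probability T R | finitely_supported Q]]))%E.

End entropy.

Section sampling.
Context (S : Type) (R : realType) (n r : nat).

Definition sampling_prob (N : nat) : R := N%:R / #|index_set n r|%:R.

(* D_n(f) for the sample x and the selection z. *)
Definition selection_process (N : nat) (x : n.-tuple S)
    (z : index_set n r -> bool) (f : r.-tuple S -> R) : R :=
  (Num.sqrt N%:R)^-1 *
  \sum_(t : index_set n r)
    ((z t)%:R - sampling_prob N) * f (subsample x t).

(* The maximum of the selected values of a nonnegative F. *)
Definition max_selected (M : nat) (F : r.-tuple S -> R) (x : n.-tuple S)
    (z : 'I_M -> index_set n r -> bool) : R :=
  \big[Num.max/0]_(m < M) \big[Num.max/0]_(t : index_set n r)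
    ((z m t)%:R * F (subsample x t)).

End sampling.

(* For an uncountable class FF the supremum |D_n(f)|_FF need not be a random
   variable, and measurability of each f in FF does not give its expectation a
   meaning. The usual convention is that FF is pointwise measurable (each f in
   FF is a pointwise limit of a sequence in one countable subclass); the
   condition below follows from this, and is all that is used of it: for each
   fixed selection, the supremum is a measurable function of the data. *)
Definition measurable_sup d (S : measurableType d) (R : realType) (n r N : nat)
    (FF : set (r.-tuple S -> R)) : Prop :=
  forall z : index_set n r -> bool,
    measurable_fun [set: n.-tuple S]
      (fun x => sup_norm FF (selection_process N x z)).

(* Main.v *)
Require Import Defs.
From HB Require Import structures.
From mathcomp Require Import all_boot all_order all_algebra perm.
From mathcomp Require Import all_classical all_reals all_analysis.
From mathcomp Require Import measurable_realfun.
From mathcomp Require Import ring lra.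

Set Implicit Arguments.
Unset Strict Implicit.
Unset Printing Implicit Defensive.

Import Order.TTheory GRing.Theory Num.Theory.
Import numFieldNormedType.Exports.

Local Open Scope classical_set_scope.
Local Open Scope ring_scope.

(** The inequality is proved conditionally on the data and then integrated.
For a fixed sample the selections form a finite probability space, namely the
boolean functions on J = [M] x I_{n,r} with product Bernoulli weights, and the
class enters only through the bounded set of vectors (f(X_iota))_iota, so that
every conditional expectation is a finite sum and every supremum is a real
number.

Four facts are combined, of which the first three are conditional on the data.

Symmetrization ([symmetrization]): replacing Z - p by eps Z, with independent
random signs eps, costs a factor 4 for the square of a supremum and a factor 2
for a maximum of absolute values. The sign-flipped pair (Z, Z') of independent
copies is again such a pair, because it is obtained by swapping coordinates.

Chaining ([chaining], [entropy_chaining]): given the selection, the signed sum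
is subgaussian for the seminorm q_m(f)^2 = sum_iota Z^m_iota f(X_iota)^2, which
up to a factor is the L^2 norm for the uniform distribution on the selected
points. This distribution is finitely supported, so the entropy integral
controls its covering numbers at the radii 2^-k q_m(F), and the expected square
of the supremum is at most a constant times
log(2M) J(1)^2 max_m q_m(F)^2. A weighted Cauchy-Schwarz inequality over the
levels k keeps the whole argument at the level of squares.

A self-bounding estimate ([bern_max_sum]): the remaining quantity
max_m sum_iota Z^m_iota F(X_iota)^2 has mean at most
2 p sum_iota F(X_iota)^2 + C log(2M) E T^2. Its fluctuation is symmetrized
once more; the resulting square root of log(2M) T^2 max_m q_m(F)^2 is split by
the inequality of arithmetic and geometric means, and half of the left-hand
side is absorbed.

Independence ([integral_selection], [subdata_law]): as the selection takes
finitely many values and is independent of the data, an integral over the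
probability space is a finite weighted sum of integrals over the data, and each
subsample X_iota has law P^r, which turns the average of F(X_iota)^2 over iota
into P^r F^2. *)

(** * Means over a finite product of Bernoulli laws *)

Section bernoulli_weights.
Context {R : realType} {J : finType}.
Implicit Types (p : R) (z : {ffun J -> bool}).

Definition bern_prob p (b : bool) : R := if b then p else 1 - p.

Definition bern_weight p z : R := \prod_j bern_prob p (z j).

Definition bern_mean p (G : {ffun J -> bool} -> R) : R :=
  \sum_z bern_weight p z * G z.

(** Independence of the coordinates, as the distributivity of a product over
sums. *)
Lemma bern_mean_prod p (g : J -> bool -> R) :
  bern_mean p (fun z => \prod_j g j (z j)) =
  \prod_j (p * g j true + (1 - p) * g j false).
Proof.
rewrite /bern_mean /bern_weight.
transitivity (\sum_(z : {ffun J -> bool}) \prod_j (bern_prob p (z j) * g j (z j))).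
  by apply: eq_bigr => z _; rewrite big_split.
rewrite -(bigA_distr_bigA (fun j b => bern_prob p b * g j b)).
by apply: eq_bigr => j _; rewrite big_bool.
Qed.

Lemma bern_mean_cst p c : bern_mean p (fun=> c) = c.
Proof.
have := bern_mean_prod p (fun _ _ => 1).
rewrite /bern_mean => H; rewrite -big_distrl/= -[RHS]mul1r; congr (_ * _).
transitivity (\sum_z bern_weight p z * \prod_(j : J) (1 : R)).
  by apply: eq_bigr => z _; rewrite big1// mulr1.
by rewrite H big1// => j _; ring.
Qed.

Lemma bern_mean_coord p j : bern_mean p (fun z => (z j)%:R) = p.
Proof.
transitivity (bern_mean p
    (fun z => \prod_i (if i == j then (z i)%:R else 1))).
  by apply: eq_bigr => z _; rewrite -big_mkcond big_pred1_eq.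
rewrite (bern_mean_prod p (fun i b => if i == j then b%:R else 1)).
rewrite (bigD1 j)//= eqxx big1 => [|i /negbTE ->]; ring.
Qed.

Lemma bern_weight_ge0 p z : 0 <= p <= 1 -> 0 <= bern_weight p z.
Proof.
move=> /andP[p0 p1]; apply: prodr_ge0 => j _; rewrite /bern_prob.
by case: (z j); rewrite ?subr_ge0.
Qed.

Lemma eq_bern_mean p G G' : G =1 G' -> bern_mean p G = bern_mean p G'.
Proof. by move=> GG'; apply: eq_bigr => z _; rewrite GG'. Qed.

Lemma bern_meanD p G G' :
  bern_mean p (fun z => G z + G' z) = bern_mean p G + bern_mean p G'.
Proof. by rewrite -big_split; apply: eq_bigr => z _; rewrite mulrDr. Qed.

Lemma bern_meanZ p c G : bern_mean p (fun z => c * G z) = c * bern_mean p G.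
Proof.
by rewrite /bern_mean big_distrr; apply: eq_bigr => z _; rewrite mulrCA.
Qed.

Lemma bern_mean_sum p (I : finType) (P : pred I) (G : I -> {ffun J -> bool} -> R) :
  bern_mean p (fun z => \sum_(i | P i) G i z) = \sum_(i | P i) bern_mean p (G i).
Proof.
by rewrite exchange_big; apply: eq_bigr => z _; rewrite big_distrr.
Qed.

Lemma bern_mean_le p G G' : 0 <= p <= 1 -> (forall z, G z <= G' z) ->
  bern_mean p G <= bern_mean p G'.
Proof.
by move=> p01 GG'; apply: ler_sum => z _; rewrite ler_wpM2l// bern_weight_ge0.
Qed.

Lemma bern_mean_ge0 p G : 0 <= p <= 1 -> (forall z, 0 <= G z) ->
  0 <= bern_mean p G.
Proof.
by move=> p01 G0; apply: sumr_ge0 => z _; rewrite mulr_ge0// bern_weight_ge0.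
Qed.

(** Jensen's inequality for the square: the variance is nonnegative. *)
Lemma bern_mean_sqr p G : 0 <= p <= 1 ->
  bern_mean p G ^+ 2 <= bern_mean p (fun z => G z ^+ 2).
Proof.
move=> p01; set m := bern_mean p G.
have : 0 <= bern_mean p (fun z => (G z - m) ^+ 2).
  by apply: bern_mean_ge0 => // z; rewrite sqr_ge0.
rewrite (@eq_bern_mean _ _ (fun z => G z ^+ 2 + ((- 2 * m) * G z + m ^+ 2))); last first.
  by move=> z; ring.
rewrite !bern_meanD bern_meanZ bern_mean_cst -/m; nra.
Qed.

End bernoulli_weights.

Arguments bern_weight {R J}.
Arguments bern_mean {R J}.

(** * Subgaussian maxima of sign sums *)

Section rademacher.
Context {R : realType} {J : finType}.

Definition rad_sign (b : bool) : R := if b then 1 else -1.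

Definition rad_mean : ({ffun J -> bool} -> R) -> R := bern_mean 2^-1.

Definition rad_sum (l : J -> R) (e : {ffun J -> bool}) : R :=
  \sum_j rad_sign (e j) * l j.

Lemma half_in01 : 0 <= (2^-1 : R) <= 1.
Proof. by apply/andP; split; lra. Qed.

(** Everything follows from [1 + y <= exp y]: for [|x| <= 1/2] it bounds
[exp x] by [1 / (1 - x)], hence by [1 + x + 2 x^2], and the linear terms cancel;
for larger [x] the exponent [2 x^2] exceeds [|x|]. The constant 2 in place of
the optimal 1/2 is the price of this short proof. *)
Lemma cosh_le (x : R) : (expR x + expR (- x)) / 2 <= expR (2 * x ^+ 2).
Proof.
wlog x0 : x / 0 <= x.
  move=> H; have [/H//|/ltW x0] := leP 0 x.
  by have := H (- x); rewrite opprK sqrrN addrC; apply; rewrite oppr_ge0.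
have [xh|xh] := leP x 2^-1.
  have bnd (y : R) : `|y| <= 2^-1 -> expR y <= 1 + y + 2 * y ^+ 2.
    rewrite ler_norml => /andP[y1 y2].
    have y3 : 0 < 1 - y by lra.
    have := expR_ge1Dx (- y); rewrite expRN => H.
    have H1 : expR y * (1 - y) <= 1.
      by rewrite -ler_pdivlMl ?expR_gt0// mulr1.
    rewrite -(ler_pM2r y3) (le_trans H1)//; nra.
  have := bnd x; have := bnd (- x).
  rewrite normrN ger0_norm// => /(_ xh) H1 /(_ xh) H2.
  have := expR_ge1Dx (2 * x ^+ 2); nra.
have H1 : expR (- x) <= expR x by rewrite ler_expR; lra.
apply: (@le_trans _ _ (expR x)); first lra.
rewrite ler_expR; nra.
Qed.

Lemma rad_mgf (l : J -> R) (s : R) : \sum_j l j ^+ 2 <= s ->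
  rad_mean (fun e => expR (rad_sum l e)) <= expR (2 * s).
Proof.
move=> ls; rewrite /rad_mean.
rewrite (@eq_bern_mean _ _ _ _ (fun e => \prod_j expR (rad_sign (e j) * l j))); last first.
  by move=> e; rewrite /rad_sum expR_sum.
rewrite (bern_mean_prod _ (fun j b => expR (rad_sign b * l j))).
apply: (@le_trans _ _ (\prod_j expR (2 * l j ^+ 2))).
  apply: ler_prod => j _ /=; rewrite mul1r mulN1r.
  have e1 := expR_ge0 (l j); have e2 := expR_ge0 (- l j).
  apply/andP; split; first lra.
  apply: le_trans (cosh_le _); lra.
by rewrite -expR_sum ler_expR -mulr_sumr ler_wpM2l.
Qed.

Lemma rad_sumZ c l e : rad_sum (fun j => c * l j) e = c * rad_sum l e.
Proof. by rewrite /rad_sum big_distrr; apply: eq_bigr => j _; rewrite mulrCA. Qed.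

(** Converts a bound on exponential moments into a bound on second moments:
only the part of [y] above the level [L] is charged to the exponential. *)
Lemma sqr_le_expR (L y : R) : 0 <= L -> 0 <= y ->
  y ^+ 2 <= 2 * L ^+ 2 + 8 * expR (y - L).
Proof.
move=> L0 y0; have e0 := expR_ge0 (y - L); have [yL|yL] := leP y L; first nra.
have : (1 + (y - L) / 2) ^+ 2 <= expR (y - L).
  have h0 : 0 <= (y - L) / 2 by lra.
  have h1 := expR_ge1Dx ((y - L) / 2).
  rewrite [X in expR X](_ : y - L = (y - L) / 2 + (y - L) / 2); last by field.
  rewrite expRD expr2; apply: ler_pM => //; lra.
have := sqr_ge0 (2 * L - y); nra.
Qed.

Lemma ln2_ge : 2^-1 <= ln 2 :> R.
Proof.
have := @ln_sublinear R 2^-1.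
have : ln 2 = - ln 2^-1 :> R by rewrite lnV ?opprK// posrE.
have := @le_ln1Dx R (- 2^-1); rewrite (_ : 1 - 2^-1 = 2^-1 :> R); last by field.
move=> H -> _; have := H _; lra.
Qed.

End rademacher.
Arguments rad_sign {R}.

Section rademacher_max.
Context {R : realType} {J : finType}.

Lemma ln_double_ge (m : nat) : (0 < m)%N -> 2^-1 <= ln (2 * m)%:R :> R.
Proof.
move=> m0; apply: le_trans (ln2_ge) _.
by rewrite ler_ln ?posrE ?ltr0n ?muln_gt0// ler_nat leq_pmulr.
Qed.

(** A maximum of squares of [#|I|] subgaussian sums costs only a logarithm:
[sqr_le_expR] dominates every square by the same level plus an exponential, the
sum of all the exponentials dominates the largest one, and the level is chosen
so that this sum has mean of order one. *)
Lemma rad_mean_max (I : finType) (l : I -> J -> R) (s : R) :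
  (0 < #|I|)%N -> (forall i, \sum_j l i j ^+ 2 <= s) ->
  rad_mean (fun e => \big[Num.max/0]_i rad_sum (l i) e ^+ 2) <=
  80 * s * ln (2 * #|I|)%:R.
Proof.
move=> I0 ls; have h01 := half_in01 (R := R).
set L := ln (2 * #|I|)%:R; have L2 : 2^-1 <= L by exact: ln_double_ge.
have s0 : 0 <= s.
  have /card_gt0P[i _] := I0; apply: le_trans (ls i).
  by apply: sumr_ge0 => j _; rewrite sqr_ge0.
have [s00|sn0] := eqVneq s 0.
  rewrite /rad_mean (@eq_bern_mean _ _ _ _ (fun=> 0)) ?bern_mean_cst ?s00 ?mulr0 ?mul0r//.
  move=> e; apply: (big_ind (fun x => x = 0)) => // [x y -> ->|i _]; first by rewrite maxxx.
  suff l0 j : l i j = 0 by rewrite /rad_sum big1 ?expr0n// => j _; rewrite l0 mulr0.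
  apply/eqP; rewrite -sqrf_eq0 eq_le sqr_ge0 andbT -s00.
  apply: le_trans (ls i); rewrite (bigD1 j)//= lerDl.
  by apply: sumr_ge0 => k _; rewrite sqr_ge0.
have sp : 0 < s by rewrite lt_neqAle eq_sym sn0.
(* With this scaling each exponential moment is at most
   [expR (2 * lam ^+ 2 * s) = expR L = (2 * #|I|)%:R], so that the truncation
   level [2 * L] balances the [2 * #|I|] exponentials. *)
pose lam := Num.sqrt (L / (2 * s)).
have lam0 : 0 <= lam by exact: sqrtr_ge0.
have lam2 : lam ^+ 2 = L / (2 * s) by rewrite sqr_sqrtr// divr_ge0//; lra.
pose G e := \sum_(i : I) (expR (rad_sum (fun j => lam * l i j) e) +
                    expR (rad_sum (fun j => - lam * l i j) e)).
have G0 e : 0 <= G e by apply: sumr_ge0 => i _; rewrite addr_ge0 ?expR_ge0.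
have pt e : lam ^+ 2 * \big[Num.max/0]_i rad_sum (l i) e ^+ 2 <=
            2 * (2 * L) ^+ 2 + (8 * expR (- (2 * L))) * G e.
  have B0 : 0 <= 2 * (2 * L) ^+ 2 + (8 * expR (- (2 * L))) * G e.
    by apply: addr_ge0; apply: mulr_ge0; rewrite ?sqr_ge0// mulr_ge0 ?expR_ge0.
  rewrite mulrC -ler_pdivlMr; last by rewrite lam2 divr_gt0//; lra.
  apply: bigmax_le => [|i _]; first by rewrite divr_ge0// sqr_ge0.
  rewrite ler_pdivlMr; last by rewrite lam2 divr_gt0//; lra.
  rewrite mulrC -exprMn -real_normK ?num_real//.
  have L20 : 0 <= 2 * L by lra.
  apply: le_trans (sqr_le_expR L20 (normr_ge0 _)) _.
  rewrite lerD2l expRD mulrA mulrAC ler_wpM2l ?mulr_ge0 ?expR_ge0//.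
  apply: (@le_trans _ _ (expR (rad_sum (fun j => lam * l i j) e) +
                    expR (rad_sum (fun j => - lam * l i j) e))).
    rewrite !rad_sumZ mulNr; set x := lam * _.
    have := expR_ge0 x; have := expR_ge0 (- x).
    by have [x0|x0] := leP 0 x; [rewrite ger0_norm|rewrite ltr0_norm]; lra.
  rewrite /G (bigD1 i)//= lerDl; apply: sumr_ge0 => k _.
  by rewrite addr_ge0 ?expR_ge0.
have EG : rad_mean G <= (2 * #|I|)%:R * expR L.
  rewrite /rad_mean bern_mean_sum.
  apply: (@le_trans _ _ (\sum_(i : I) (expR L + expR L))).
    apply: ler_sum => i _; rewrite bern_meanD; apply: lerD.
      have -> : L = 2 * (lam ^+ 2 * s) by rewrite lam2; field.
      apply: rad_mgf; under eq_bigr do rewrite exprMn.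
      by rewrite -big_distrr/= ler_wpM2l ?sqr_ge0.
    have -> : L = 2 * (lam ^+ 2 * s) by rewrite lam2; field.
    apply: rad_mgf; under eq_bigr do rewrite exprMn sqrrN.
    by rewrite -big_distrr/= ler_wpM2l ?sqr_ge0.
  by rewrite sumr_const -mulr_natl natrM le_eqVlt; apply/orP; left; apply/eqP; ring.
have := bern_mean_le h01 pt.
rewrite bern_meanZ bern_meanD bern_mean_cst bern_meanZ.
rewrite -/(rad_mean G) -/(rad_mean _); set Y := rad_mean (fun e => \big[_/_]_i _).
move=> H.
have e1 : (8 * expR (- (2 * L))) * rad_mean G <= 8.
  apply: le_trans (ler_wpM2l _ EG) _; first by rewrite mulr_ge0 ?expR_ge0.
  have -> : (2 * #|I|)%:R = expR L :> R by rewrite lnK// posrE ltr0n muln_gt0.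
  rewrite -expRD -mulrA -expRD (_ : _ + _ = 0) ?expR0 ?mulr1//; ring.
have {H} : L * Y <= (8 * L ^+ 2 + 8) * (2 * s).
  rewrite -ler_pdivrMr; last by lra.
  rewrite mulrAC -lam2; apply: le_trans H _.
  apply: le_trans (lerD (lexx _) e1) _; lra.
move=> H.
rewrite -(@ler_pM2l _ L); last by lra.
apply: le_trans H _.
have : 0 <= s * (L ^+ 2 - 4^-1) by rewrite mulr_ge0//; nra.
lra.
Qed.

End rademacher_max.

(** * Chaining for masked sign sums *)

Section chaining.
Context {R : realType} {T : finType} {M : nat}.
Variable z : 'I_M * T -> bool.

(** The weighted variance of [x i / w i] around the ratio of the two sums is
nonnegative. *)
Lemma weighted_cauchy_schwarz (I : finType) (w x : I -> R) :
  (forall i, 0 < w i) ->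
  (\sum_i x i) ^+ 2 <= (\sum_i w i) * \sum_i (x i ^+ 2 / w i).
Proof.
move=> w0; set X := \sum_i x i; set W := \sum_i w i; set B := \sum_i _ / _.
have [/card0_eq I0|/card_gt0P[i0 _]] := posnP #|I|.
  by rewrite /X /W !big_pred0 ?expr0n ?mul0r.
have W0 : 0 < W.
  rewrite /W (bigD1 i0)//= ltr_pwDl// sumr_ge0// => i _; exact: ltW.
have : 0 <= \sum_i w i * (x i / w i - X / W) ^+ 2.
  by apply: sumr_ge0 => i _; rewrite mulr_ge0 ?sqr_ge0// ltW.
rewrite (eq_bigr (fun i => x i ^+ 2 / w i + (- 2 * (X / W)) * x i + (X / W) ^+ 2 * w i)).
  rewrite !big_split/= -!big_distrr/= -/X -/W -/B => H.
  have -> : X ^+ 2 = W * (X ^+ 2 / W) by field; rewrite gt_eqF.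
  rewrite ler_pM2l//.
  have : B + -2 * (X / W) * X + (X / W) ^+ 2 * W = B - X ^+ 2 / W.
    by field; rewrite gt_eqF.
  move=> E; move: H; rewrite E; lra.
by move=> i _; field; rewrite !gt_eqF.
Qed.

Definition masked_sqnorm (m : 'I_M) (v : T -> R) : R :=
  \sum_t (z (m, t))%:R * v t ^+ 2.

Definition masked_vector (m : 'I_M) (v : T -> R) (j : 'I_M * T) : R :=
  if j.1 == m then (z j)%:R * v j.2 else 0.

Definition masked_sum m (v : T -> R) e : R := rad_sum (masked_vector m v) e.

Lemma sum_masked (m : 'I_M) (g : T -> R) :
  \sum_(j : 'I_M * T) (if j.1 == m then g j.2 else 0) = \sum_t g t.
Proof.
rewrite -(pair_bigA _ (fun i t => if i == m then g t else 0))/= (bigD1 m)//=.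
rewrite [X in _ + X]big1 ?addr0 => [|i /negbTE im].
  by apply: eq_bigr => t _; rewrite eqxx.
by rewrite big1// => t _; rewrite im.
Qed.

Lemma sum_masked_vector m v : \sum_j masked_vector m v j ^+ 2 = masked_sqnorm m v.
Proof.
rewrite /masked_sqnorm -(sum_masked m (fun t => (z (m, t))%:R * v t ^+ 2)).
apply: eq_bigr => -[i t] _; rewrite /masked_vector/=; case: eqP => [->|_].
  by rewrite exprMn -natrX; case: (z _).
by rewrite expr0n.
Qed.

Lemma masked_sumE m v e :
  masked_sum m v e = \sum_t rad_sign (e (m, t)) * ((z (m, t))%:R * v t).
Proof.
rewrite -(sum_masked m (fun t => rad_sign (e (m, t)) * ((z (m, t))%:R * v t))).
apply: eq_bigr => -[i t] _; rewrite /masked_vector/=.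
by case: eqP => [->//|_]; rewrite mulr0.
Qed.

Lemma masked_sumB m u v e :
  masked_sum m (fun t => u t - v t) e = masked_sum m u e - masked_sum m v e.
Proof.
rewrite !masked_sumE -sumrB; apply: eq_bigr => t _; ring.
Qed.

Lemma masked_sum_sqr_le m v e : masked_sum m v e ^+ 2 <= #|T|%:R * masked_sqnorm m v.
Proof.
rewrite masked_sumE.
have := @weighted_cauchy_schwarz T (fun=> 1)
  (fun t => rad_sign (e (m, t)) * ((z (m, t))%:R * v t)) (fun=> ltr01).
rewrite sumr_const => /le_trans; apply; rewrite ler_wpM2l ?ler0n//.
apply: ler_sum => t _; rewrite divr1 !exprMn /rad_sign.
by case: (e _); case: (z _); rewrite ?sqrrN ?expr1n ?expr0n/= ?mul1r ?mul0r ?mulr0.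
Qed.

(** A triangle inequality between squares, which avoids square roots at the
cost of a factor 2. *)
Lemma masked_sqnorm_triangle m u v w a b :
  masked_sqnorm m (fun t => u t - v t) <= a ->
  masked_sqnorm m (fun t => u t - w t) <= b ->
  masked_sqnorm m (fun t => w t - v t) <= 2 * a + 2 * b.
Proof.
move=> ha hb; apply: le_trans (lerD (ler_wpM2l _ ha) (ler_wpM2l _ hb)); [|lra|lra].
rewrite /masked_sqnorm !big_distrr -big_split/=; apply: ler_sum => t _.
have : 0 <= ((u t - v t) + (u t - w t)) ^+ 2 by rewrite sqr_ge0.
case: (z _) => /=; rewrite ?mul0r ?mul1r; nra.
Qed.

(** Dudley's chaining bound for the second moment of a maximum over the masks.
Each vector of [A] is reached from [c m 0 _ = 0] through approximations at the
squared radii [4 * 4^-k * s]. The increments between the levels [k] and [k + 1]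
form a family of at most [M * nu k * nu k.+1] sign sums, to which
[rad_mean_max] applies; the weights [w k = 2^-k * b k] in the Cauchy-Schwarz
inequality are proportional to the expected size of the largest increment, so
that both factors are bounded by the entropy sum [W]. The bound is stated as a
majorant [V], which makes a supremum over [A] unnecessary here. *)
Lemma chaining (A : set (T -> R)) (s W : R) (c : 'I_M -> nat -> nat -> T -> R)
    (nu : nat -> nat) (b : nat -> R) :
  (0 < M)%N -> 0 <= s ->
  (forall m i t, c m 0%N i t = 0) ->
  (forall k, (0 < nu k)%N) -> (forall k, (nu k <= nu k.+1)%N) ->
  (forall k, 0 <= b k) -> (forall k, 1 + ln (nu k.+1)%:R <= b k ^+ 2) ->
  (forall m k v, A v -> exists2 i, (i < nu k)%N &
     masked_sqnorm m (fun t => v t - c m k i t) <= 4 * 4^-1 ^+ k * s) ->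
  (forall K, \sum_(k < K) 2^-1 ^+ k * b k <= W) ->
  exists2 V : {ffun 'I_M * T -> bool} -> R,
    forall e m v, A v -> masked_sum m v e ^+ 2 <= V e &
    rad_mean V <= 80 * 81 * ln (2 * M)%:R * s * W ^+ 2.
Proof.
move=> M0 s0 c0 nu0 nuS b0 bnu cov bW.
have b1 k : 1 <= b k.
  have : 1 <= b k ^+ 2.
    apply: le_trans (bnu k); rewrite lerDl ln_ge0// ler1n; exact: nu0.
  by have := b0 k; nra.
pose w k := 2^-1 ^+ k * b k.
have w0 k : 0 < w k by rewrite mulr_gt0 ?exprn_gt0//; have := b1 k; lra.
have W1 : 1 <= W.
  have := bW 1%N; rewrite big_ord1 expr0 mul1r; have := b1 0%N; lra.
(* At this depth the remaining error is at most [s], since [4 * #|T| <= 4 ^ K]. *)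
pose K := #|T|.+1.
pose d k (x : 'I_M * 'I_(nu k) * 'I_(nu k.+1)) t :=
  c x.1.1 k.+1 x.2 t - c x.1.1 k x.1.2 t.
(* Pairs of distant centers occur in no chain; their link is replaced by 0. *)
pose lk k (x : 'I_M * 'I_(nu k) * 'I_(nu k.+1)) : 'I_M * T -> R :=
  if masked_sqnorm x.1.1 (d k x) <= 10 * 4^-1 ^+ k * s
  then masked_vector x.1.1 (d k x) else fun=> 0.
pose Vk k e := \big[Num.max/0]_x rad_sum (lk k x) e ^+ 2.
pose V e := 2 * W * (\sum_(k < K) (w k)^-1 * Vk k e) + 2 * s.
exists V => [e m v Av|].
  have /choice[i iP] : forall k, exists i, (i < nu k)%N /\
      masked_sqnorm m (fun t => v t - c m k i t) <= 4 * 4^-1 ^+ k * s.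
    by move=> k; have [i ? ?] := cov m k v Av; exists i.
  pose p k := masked_sum m (c m k (i k)) e.
  have link k : (p k.+1 - p k) ^+ 2 <= Vk k e.
    rewrite /p -masked_sumB.
    have [ik _] := iP k; have [ikS _] := iP k.+1.
    pose x : 'I_M * 'I_(nu k) * 'I_(nu k.+1) := (m, Ordinal ik, Ordinal ikS).
    have -> : masked_sum m (fun t => c m k.+1 (i k.+1) t - c m k (i k) t) e
       = rad_sum (lk k x) e.
      rewrite /lk ifT//=.
      have [_ H1] := iP k; have [_ H2] := iP k.+1.
      apply: le_trans (masked_sqnorm_triangle H1 H2) _.
      by rewrite exprS; lra.
    by rewrite /Vk (bigmax_sup x).
  have p0 : p 0%N = 0.
    by rewrite /p masked_sumE big1// => t _; rewrite c0 !mulr0.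
  have -> : masked_sum m v e = (\sum_(k < K) (p k.+1 - p k)) +
      masked_sum m (fun t => v t - c m K (i K) t) e.
    rewrite -(big_mkord xpredT (fun k => p k.+1 - p k)).
    by rewrite telescope_sumr// p0 masked_sumB subr0 -/(p K) addrC subrK.
  have H1 : (\sum_(k < K) (p k.+1 - p k)) ^+ 2 <=
      W * \sum_(k < K) (w k)^-1 * Vk k e.
    apply: le_trans (weighted_cauchy_schwarz _ (fun k : 'I_K => w0 k)) _.
    apply: ler_pM.
    - by apply: sumr_ge0 => k _; exact: ltW.
    - by apply: sumr_ge0 => k _; rewrite divr_ge0 ?sqr_ge0// ltW.
    - exact: bW.
    - by apply: ler_sum => k _; rewrite mulrC ler_wpM2l// invr_ge0 ltW.
  have H2 : masked_sum m (fun t => v t - c m K (i K) t) e ^+ 2 <= s.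
    apply: le_trans (masked_sum_sqr_le _ _ _) _.
    have [_ H] := iP K; apply: le_trans (ler_wpM2l (ler0n _ _) H) _.
    rewrite -[X in _ <= X]mul1r mulrA ler_wpM2r// mulrA exprVn.
    rewrite ler_pdivrMr ?exprn_gt0// mul1r /K exprS mulrC ler_pM2l// -natrX ler_nat.
    exact/ltnW/ltn_expl.
  set X := \sum_(k < K) (p _ - _); set Y := masked_sum _ _ _.
  rewrite /V -mulrA; move: H1 H2; rewrite -/X -/Y.
  have := sqr_ge0 (X - Y); nra.
have L2 : 2^-1 <= ln (2 * M)%:R :> R by exact: ln_double_ge.
rewrite /rad_mean bern_meanD bern_mean_cst bern_meanZ bern_mean_sum.
set L := ln _ in L2 *.
(* 80 comes from [rad_mean_max], 10 from the length of a link, and 4 from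
   [ln (2 * M * nu k * nu k.+1) <= 4 * L * b k ^+ 2]. *)
have H k : bern_mean 2^-1 (fun e => (w k)^-1 * Vk k e) <= 3200 * L * s * w k.
  rewrite bern_meanZ -/(rad_mean _).
  apply: (@le_trans _ _ ((w k)^-1 * (80 * (10 * 4^-1 ^+ k * s) * (4 * L * b k ^+ 2)))).
    rewrite ler_wpM2l ?invr_ge0 ?(ltW (w0 k))//.
    apply: le_trans (@rad_mean_max _ _ _ (lk k) (10 * 4^-1 ^+ k * s) _ _) _.
    - by rewrite !card_prod !card_ord !muln_gt0 M0 !nu0.
    - move=> x; rewrite /lk; case: ifPn => [|_]; first by rewrite sum_masked_vector.
      rewrite big1 => [|? _]; last by rewrite expr0n.
      by rewrite !mulr_ge0// exprn_ge0// invr_ge0.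
    rewrite ler_wpM2l//; first by rewrite !mulr_ge0// exprn_ge0// invr_ge0.
    rewrite !card_prod !card_ord !mulnA natrM.
    rewrite lnM ?posrE ?ltr0n ?muln_gt0 ?M0 ?nu0//.
    rewrite natrM lnM ?posrE ?ltr0n ?muln_gt0 ?M0 ?nu0// -/L.
    have n1 : ln (nu k)%:R <= ln (nu k.+1)%:R :> R.
      by rewrite ler_ln ?posrE ?ltr0n ?nu0// ler_nat.
    have n0 : 0 <= ln (nu k)%:R :> R by rewrite ln_ge0// ler1n nu0.
    have := bnu k; nra.
  rewrite le_eqVlt; apply/orP; left; apply/eqP.
  have -> : 4^-1 = 2^-1 ^+ 2 :> R by field.
  rewrite -exprM mulnC exprM -/(w k).
  have -> : b k = w k / 2^-1 ^+ k.
    by rewrite /w mulrC mulKf// expf_neq0// invr_eq0 pnatr_eq0.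
  have p0 : 2^-1 ^+ k != 0 :> R by rewrite expf_neq0// invr_eq0 pnatr_eq0.
  have := w0 k => /gt_eqF/negbT wn0; field; exact/andP.
have H3 : \sum_(k < K) bern_mean 2^-1 (fun e => (w k)^-1 * Vk k e) <= 3200 * L * s * W.
  apply: le_trans (ler_sum _ (fun (k : 'I_K) _ => H k)) _.
  rewrite -big_distrr/=; apply: ler_wpM2l (bW K).
  have Ls : 0 <= L * s by rewrite mulr_ge0//; lra.
  lra.
(* The total [2 * 3200 + 4] is rounded up to [80 * 81]. *)
apply: le_trans (lerD (ler_wpM2l _ H3) (lexx _)) _; first lra.
have W2 : 1 <= W ^+ 2 by nra.
have Ls : 0 <= s * (L - 2^-1) by rewrite mulr_ge0//; lra.
have : 0 <= L * s * (W ^+ 2 - 1) by rewrite !mulr_ge0//; lra.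
lra.
Qed.

End chaining.

(** * Symmetrization *)

Section symmetrization.
Context {R : realType} {J : finType}.

Definition swap_coords (e : {ffun J -> bool})
    (zz : {ffun J -> bool} * {ffun J -> bool}) :=
  ([ffun j => if e j then zz.1 j else zz.2 j],
   [ffun j => if e j then zz.2 j else zz.1 j]).

Lemma swap_coordsK e : involutive (swap_coords e).
Proof.
by move=> [z z']; congr pair; apply/ffunP => j; rewrite !ffunE/=; case: (e j).
Qed.

(** Exchanging the coordinates of an independent copy with those of [z] where
the sign is negative preserves the product weights and flips the sign of the
difference there. *)
Lemma bern_mean_swap p (e : {ffun J -> bool}) (H : (J -> R) -> R) :
  bern_mean p (fun z => bern_mean p (fun z' =>
    H (fun j => (z j)%:R - (z' j)%:R))) =
  bern_mean p (fun z => bern_mean p (fun z' =>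
    H (fun j => rad_sign (e j) * (z j)%:R - rad_sign (e j) * (z' j)%:R))).
Proof.
pose G (g : {ffun J -> bool} -> {ffun J -> bool} -> R) :=
  \sum_(zz : {ffun J -> bool} * {ffun J -> bool})
    (bern_weight p zz.1 * bern_weight p zz.2) * g zz.1 zz.2.
have GE g : bern_mean p (fun z => bern_mean p (g z)) = G g.
  rewrite /G -(pair_bigA _ (fun z z' => (bern_weight p z * bern_weight p z') * g z z'))/=.
  apply: eq_bigr => z _; rewrite /bern_mean big_distrr/=.
  by apply: eq_bigr => z' _; rewrite mulrA.
rewrite !GE /G (reindex_inj (can_inj (swap_coordsK e))).
apply: eq_bigr => -[z z'] _ /=; congr (_ * H _).
  rewrite /bern_weight -!big_split/=; apply: eq_bigr => j _; rewrite !ffunE.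
  by case: (e j) => //; rewrite mulrC.
apply/funext => j; rewrite !ffunE; case: (e j) => /=; ring.
Qed.

(** [Phi] is the supremum of [theta] over a class of linear functionals; the
two hypotheses saying so avoid committing to a particular supremum. It is used
with [theta] the absolute value, where [K = 1], and with [theta] the square,
where [K = 2]. *)
Lemma symmetrization (p K : R) (Phi : (J -> R) -> R) (L : set (J -> R))
    (theta : R -> R) :
  0 <= p <= 1 ->
  (forall G : {ffun J -> bool} -> R,
    theta (bern_mean p G) <= bern_mean p (theta \o G)) ->
  (forall x y, theta (x - y) <= K * (theta x + theta y)) ->
  (forall v l, L l -> theta (\sum_j l j * v j) <= Phi v) ->
  (forall v y, (forall l, L l -> theta (\sum_j l j * v j) <= y) -> Phi v <= y) ->
  0 <= K ->
  bern_mean p (fun z => Phi (fun j => (z j)%:R - p)) <=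
  2 * K * bern_mean p (fun z =>
    rad_mean (fun e : {ffun J -> bool} => Phi (fun j => rad_sign (e j) * (z j)%:R))).
Proof.
move=> p01 jensen quasi ub lub K0.
(* Centering is the mean over an independent copy, and convexity moves the
   mean outside. *)
have step1 z : Phi (fun j => (z j)%:R - p) <=
    bern_mean p (fun z' => Phi (fun j => (z j)%:R - (z' j)%:R)).
  apply: lub => l Ll.
  have -> : \sum_j l j * ((z j)%:R - p) =
      bern_mean p (fun z' : {ffun J -> bool} => \sum_j l j * ((z j)%:R - (z' j)%:R)).
    rewrite bern_mean_sum; apply: eq_bigr => j _.
    rewrite bern_meanZ -{1}(bern_mean_coord p j); congr (_ * _).
    under [RHS]eq_bern_mean => z' do rewrite -mulN1r.
    by rewrite bern_meanD bern_mean_cst bern_meanZ mulN1r.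
  apply: le_trans (jensen _) _; apply: bern_mean_le => // z'; exact: ub.
have PhiB u v : Phi (fun j => u j - v j) <= K * (Phi u + Phi v).
  apply: lub => l Ll.
  have -> : \sum_j l j * (u j - v j) = \sum_j l j * u j - \sum_j l j * v j.
    by rewrite -sumrB; apply: eq_bigr => j _; rewrite mulrBr.
  by apply: le_trans (quasi _ _) _; rewrite ler_wpM2l// lerD// ub.
set X := bern_mean p (fun z : {ffun J -> bool} => bern_mean p
  (fun z' : {ffun J -> bool} => Phi (fun j => (z j)%:R - (z' j)%:R))).
have lhsX : bern_mean p (fun z : {ffun J -> bool} => Phi (fun j => (z j)%:R - p)) <= X.
  exact: bern_mean_le.
apply: le_trans lhsX _.
have -> : X = rad_mean (fun e : {ffun J -> bool} => X) by rewrite /rad_mean bern_mean_cst.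
pose Y e := bern_mean p (fun z : {ffun J -> bool} => Phi (fun j => rad_sign (e j) * (z j)%:R)).
apply: (@le_trans _ _ (rad_mean (fun e : {ffun J -> bool} => 2 * K * Y e))).
  apply: bern_mean_le; first exact: half_in01.
  move=> e; rewrite /X (bern_mean_swap p e).
  apply: (@le_trans _ _ (bern_mean p (fun z : {ffun J -> bool} =>
     bern_mean p (fun z' : {ffun J -> bool} =>
       K * (Phi (fun j => rad_sign (e j) * (z j)%:R) +
            Phi (fun j => rad_sign (e j) * (z' j)%:R)))))).
    apply: bern_mean_le => // z; apply: bern_mean_le => // z'; exact: PhiB.
  under eq_bern_mean => z do rewrite bern_meanZ bern_meanD bern_mean_cst.
  rewrite bern_meanZ bern_meanD bern_mean_cst -/(Y e); lra.
rewrite /rad_mean bern_meanZ ler_wpM2l ?mulr_ge0//.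
rewrite /Y /bern_mean le_eqVlt; apply/orP; left; apply/eqP.
under eq_bigr do rewrite big_distrr/=.
rewrite exchange_big/=; apply: eq_bigr => z _; rewrite big_distrr/=.
by apply: eq_bigr => e _; rewrite mulrCA.
Qed.

End symmetrization.

(** * The supremum over a class, given the data *)

Section conditional.
Context {R : realType} {T : finType} {M : nat}.
Variable p : R.
Hypothesis p01 : 0 <= p <= 1.
Hypothesis M0 : (0 < M)%N.
Notation selection := {ffun 'I_M * T -> bool}.

Lemma sum_row (m : 'I_M) (a : T -> R) (v : 'I_M * T -> R) :
  \sum_j (if j.1 == m then a j.2 else 0) * v j = \sum_t a t * v (m, t).
Proof.
rewrite -(sum_masked m (fun t => a t * v (m, t))).
by apply: eq_bigr => -[i t] _ /=; case: eqP => [->//|_]; rewrite mul0r.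
Qed.

Lemma masked_sum_row (m : 'I_M) (a : T -> R) (z e : selection) :
  masked_sum z m a e = \sum_t a t * (rad_sign (e (m, t)) * (z (m, t))%:R).
Proof. by rewrite masked_sumE; apply: eq_bigr => t _; ring. Qed.

(** A self-bounding argument. By symmetrization the fluctuation of the maximum
[W] around its mean is governed by sign sums with squared coefficients
[sum_t z a^2 <= top * W], hence by the square root of [ln (2M) * top * W], which
is at most [W / 2] plus a multiple of [ln (2M) * top]; the term [W / 2] is
absorbed on the left. *)
Lemma bern_max_sum (a : T -> R) (top : selection -> R) :
  (forall t, 0 <= a t) -> (forall z, 0 <= top z) ->
  (forall (z : selection) m t, (z (m, t))%:R * a t <= top z) ->
  bern_mean p (fun z : selection => \big[Num.max/0]_(m < M) \sum_t (z (m, t))%:R * a t) <=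
  2 * (p * \sum_t a t) + 4 * 80 * ln (2 * M)%:R * bern_mean p top.
Proof.
move=> a0 top0 ztop.
set W := fun z : selection => \big[Num.max/0]_(m < M) \sum_t (z (m, t))%:R * a t.
set ell := ln _; have ell2 : 2^-1 <= ell by exact: ln_double_ge.
pose Phi (v : 'I_M * T -> R) : R := \big[Num.max/0]_(m < M) `|\sum_t a t * v (m, t)|.
pose row (m : 'I_M) := fun j : 'I_M * T => if j.1 == m then a j.2 else 0.
have W0 z : 0 <= W z by exact: bigmax_ge_id.
have wm (z : selection) (m : 'I_M) : \sum_t (z (m, t))%:R * a t <= W z.
  by rewrite /W (bigmax_sup m).
have sym : bern_mean p (fun z : selection => Phi (fun j => (z j)%:R - p)) <=
    2 * 1 * bern_mean p (fun z : selection =>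
      rad_mean (fun e : selection => Phi (fun j => rad_sign (e j) * (z j)%:R))).
  apply: (@symmetrization _ _ p 1 Phi [set row m | m in setT] Num.norm) => //.
  - move=> G; apply: le_trans (ler_norm_sum _ _ _) _; apply: ler_sum => z _.
    by rewrite normrM (ger0_norm (bern_weight_ge0 _ p01)).
  - by move=> x y; rewrite mul1r ler_normB.
  - by move=> v _ [m _ <-]; rewrite sum_row /Phi (bigmax_sup m)//.
  - move=> v y H; apply: bigmax_le => [|m _].
      by apply: le_trans (H _ (ex_intro2 _ _ (Ordinal M0) I erefl)).
    by rewrite -sum_row; apply: H; exists m.
have rad (z : selection) :
    2 * rad_mean (fun e : selection => Phi (fun j => rad_sign (e j) * (z j)%:R)) <=
    2^-1 * W z + 160 * ell * top z.
  set Y := rad_mean _.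
  have Y0 : 0 <= Y.
    by apply: bern_mean_ge0 => [|e]; [exact: half_in01|exact: bigmax_ge_id].
  have Y2 : Y ^+ 2 <= 80 * (top z * W z) * ell.
    apply: le_trans (bern_mean_sqr _ half_in01) _.
    have : rad_mean (fun e : selection =>
          \big[Num.max/0]_(m < M) rad_sum (masked_vector z m a) e ^+ 2) <=
        80 * (top z * W z) * ln (2 * #|'I_M|)%:R.
      apply: rad_mean_max => [|m]; first by rewrite card_ord.
      rewrite sum_masked_vector; apply: le_trans (ler_wpM2l (top0 z) (wm z m)).
      rewrite /masked_sqnorm big_distrr/=; apply: ler_sum => t _.
      by have := ztop z m t; have := a0 t; case: (z _) => /=; nra.
    rewrite card_ord -/ell; apply: le_trans.
    apply: bern_mean_le half_in01 _ => e.
    rewrite /Phi (bigmax_eq_arg _ (Ordinal M0))//.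
    set m := Order.arg_max _ _ _; rewrite real_normK ?num_real//.
    by rewrite (bigmax_sup m)// -masked_sum_row.
  have tW : 0 <= top z * W z by rewrite mulr_ge0.
  have sq : (2 * Y) ^+ 2 <= (2^-1 * W z + 160 * ell * top z) ^+ 2.
    have := sqr_ge0 (2^-1 * W z - 160 * ell * top z); nra.
  rewrite -ler_sqr// nnegrE ?mulr_ge0// addr_ge0// ?mulr_ge0//; lra.
set EW := bern_mean p W.
have : EW <= p * \sum_t a t + bern_mean p (fun z : selection => Phi (fun j => (z j)%:R - p)).
  rewrite -[X in X + _](@bern_mean_cst _ ('I_M * T)%type p) -bern_meanD.
  apply: bern_mean_le => // z; apply: bigmax_le => [|m _].
    by rewrite addr_ge0 ?bigmax_ge_id// mulr_ge0 ?sumr_ge0//; case/andP: p01.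
  have -> : \sum_t (z (m, t))%:R * a t =
     p * (\sum_t a t) + \sum_t a t * ((z (m, t))%:R - p).
    by rewrite big_distrr -big_split/=; apply: eq_bigr => t _; ring.
  rewrite lerD2l (le_trans (ler_norm _))// /Phi.
  by rewrite (bigmax_sup m).
have : 2 * 1 * bern_mean p (fun z : selection =>
      rad_mean (fun e : selection => Phi (fun j => rad_sign (e j) * (z j)%:R))) <=
   2^-1 * EW + 160 * ell * bern_mean p top.
  rewrite mulr1 -!bern_meanZ -bern_meanD; exact: bern_mean_le.
lra.
Qed.

(** The supremum of [D_n^(m)(f)^2] over [m] and [f], up to the normalization,
as a function of the centered selection. *)
Definition sup_quadratic (A : set (T -> R)) (v : 'I_M * T -> R) : R :=
  sup [set x | exists2 m, True & exists2 f, A f & x = (\sum_t f t * v (m, t)) ^+ 2].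

Section sup_quadratic_bounds.
Variables (A : set (T -> R)) (F : T -> R).
Hypothesis A0 : A !=set0.
Hypothesis AF : forall f t, A f -> `|f t| <= F t.

Lemma sup_quadratic_ub v m f : A f ->
  (\sum_t f t * v (m, t)) ^+ 2 <= sup_quadratic A v.
Proof.
move=> Af; apply: ub_le_sup; last by exists m => //; exists f.
exists ((\sum_m \sum_t F t * `|v (m, t)|) ^+ 2) => _ [i _ [g Ag ->]].
have F0 t : 0 <= F t by apply: le_trans (AF t Ag); exact: normr_ge0.
rewrite -real_normK ?num_real// ler_sqr ?nnegrE ?sumr_ge0//; last first.
  by move=> k _; rewrite sumr_ge0// => t _; rewrite mulr_ge0.
apply: le_trans (ler_norm_sum _ _ _) _.
rewrite (bigD1 i)//= -[leLHS]addr0 lerD ?sumr_ge0//.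
  by apply: ler_sum => t _; rewrite normrM ler_wpM2r// AF.
by move=> k _; rewrite sumr_ge0// => t _; rewrite mulr_ge0.
Qed.

Lemma sup_quadratic_le v y :
  (forall m f, A f -> (\sum_t f t * v (m, t)) ^+ 2 <= y) ->
  sup_quadratic A v <= y.
Proof.
move=> H; apply: ge_sup.
  have [f Af] := A0; exists ((\sum_t f t * v (Ordinal M0, t)) ^+ 2).
  by exists (Ordinal M0) => //; exists f.
by move=> _ [m _ [f Af ->]]; exact: H.
Qed.

Lemma bern_mean_sup_quadratic (kappa : R) (top : selection -> R) :
  0 <= kappa ->
  (forall z, 0 <= top z) ->
  (forall (z : selection) m t, (z (m, t))%:R * F t ^+ 2 <= top z) ->
  (forall z : selection, exists2 V : selection -> R,
    forall e m f, A f -> masked_sum z m f e ^+ 2 <= V e &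
    rad_mean V <= kappa * \big[Num.max/0]_(m < M) masked_sqnorm z m F) ->
  bern_mean p (fun z : selection => sup_quadratic A (fun j => (z j)%:R - p)) <=
  4 * kappa * (2 * (p * \sum_t F t ^+ 2) + 4 * 80 * ln (2 * M)%:R * bern_mean p top).
Proof.
move=> k0 top0 ztop chain.
have sym : bern_mean p (fun z : selection => sup_quadratic A (fun j => (z j)%:R - p)) <=
    2 * 2 * bern_mean p (fun z : selection =>
      rad_mean (fun e : selection => sup_quadratic A (fun j => rad_sign (e j) * (z j)%:R))).
  apply: (@symmetrization _ _ p 2 (sup_quadratic A)
    [set l | exists2 m, True & exists2 f, A f &
       l = (fun j => if j.1 == m then f j.2 else 0)]
    (fun x => x ^+ 2)) => //.
  - by move=> G; exact: bern_mean_sqr.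
  - by move=> x y; have := sqr_ge0 (x + y); nra.
  - by move=> v _ [m _ [f Af ->]]; rewrite sum_row; exact: sup_quadratic_ub.
  - move=> v y H; apply: sup_quadratic_le => m f Af.
    by rewrite -sum_row; apply: H; exists m => //; exists f.
apply: le_trans sym _; rewrite (_ : 2 * 2 = 4); last by ring.
rewrite -(mulrA 4 kappa) ler_pM2l//.
apply: le_trans (ler_wpM2l k0 (bern_max_sum (fun t => sqr_ge0 (F t)) top0 ztop)).
rewrite -bern_meanZ; apply: bern_mean_le => // z.
have [V VP] := chain z; apply: le_trans.
apply: bern_mean_le; first exact: half_in01.
move=> e; apply: sup_quadratic_le => m f Af.
by rewrite -masked_sum_row; exact: VP.
Qed.

End sup_quadratic_bounds.

End conditional.

(** * Covering numbers and the entropy integral *)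

Section monotone.
Context {R : realType}.

(** The entropy integrand is monotone, hence measurable: its superlevel sets
are intervals. *)
Lemma nonincreasing_emeasurable (g : R -> \bar R) :
  (forall x y, x <= y -> (g y <= g x)%E) -> measurable_fun [set: R] g.
Proof.
move=> g_ni mD; apply: (measurability _ (ErealGenCInfty.measurableE R)) => //.
move=> _ [_ [r ->] <-]; rewrite setTI; apply: is_interval_measurable => s t /=.
rewrite !in_itv/= !andbT => gs gt u /andP[su ut].
by rewrite in_itv/= andbT (le_trans gt)// g_ni.
Qed.

(** The lower Riemann sum over the dyadic intervals [(2^-(k+1), 2^-k]]. *)
Lemma dyadic_sum_le_integral (g : R -> \bar R) (K : nat) :
  (forall x, 0 <= g x)%E -> (forall x y, x <= y -> (g y <= g x)%E) ->
  (\sum_(k < K) (2^-1 ^+ k.+1)%:E * g (2^-1 ^+ k)%R <=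
   \int[lebesgue_measure]_(x in `[0%R, 1%R]) g x)%E.
Proof.
move=> g0 g_ni; have mg := nonincreasing_emeasurable g_ni.
have h0 k : 0 <= 2^-1 ^+ k :> R by rewrite exprn_ge0// invr_ge0.
have h1 k : 2^-1 ^+ k.+1 <= 2^-1 ^+ k :> R by rewrite exprS; have := h0 k; lra.
have hle1 k : 2^-1 ^+ k <= 1 :> R by rewrite exprn_ile1// invf_le1//; lra.
have step : (\sum_(k < K) (2^-1 ^+ k.+1)%:E * g (2^-1 ^+ k)%R <=
   \int[lebesgue_measure]_(x in `](2^-1 ^+ K)%R, 1%R]) g x)%E.
  elim: K => [|K IH]; first by rewrite big_ord0 integral_ge0.
  rewrite big_ord_recr/= addeC.
  rewrite (@itv_bndbnd_setU _ _ (BRight (2^-1 ^+ K.+1)) (BRight (2^-1 ^+ K)) (BRight 1))//;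
    [|by rewrite bnd_simp|by rewrite bnd_simp].
  rewrite ge0_integral_setU//=; last 2 first.
  - exact: measurable_funTS.
  - apply/disj_setPS => x [] /=; rewrite !in_itv/= => /andP[_ a] /andP[b _].
    by move: (le_lt_trans a b); rewrite ltxx.
  apply: leeD IH.
  apply: (@le_trans _ _ (\int[lebesgue_measure]_(x in `](2^-1 ^+ K.+1)%R, (2^-1 ^+ K)%R])
      cst (g (2^-1 ^+ K)%R) x)%E).
    rewrite integral_cst//= lebesgue_measure_itv/= lte_fin.
    rewrite ifT; last by rewrite exprS gtr_pMl ?exprn_gt0// invf_lt1//; lra.
    rewrite muleC lee_wpmul2l// EFinN -EFinB lee_fin exprS; have := h0 K; lra.
  apply: ge0_le_integral => //.
  - by move=> x _; exact: g0.
  - exact: measurable_funTS.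
  - by move=> x /=; rewrite in_itv/= => /andP[_ xK]; exact: g_ni.
apply: le_trans step _; apply: ge0_subset_integral => //.
- exact: measurable_funTS.
- move=> x /=; rewrite !in_itv/= => /andP[a ->]; rewrite andbT ltW//.
  exact: le_lt_trans a.
Qed.

End monotone.

Section entropy_facts.
Context d (T : measurableType d) (R : realType).
Variables (FF : set (T -> R)) (F : T -> R).

Definition log_cover (Q : probability T R) (eps : R) : \bar R :=
  lne (covering_number (fun f g => L2 Q (fun x => f x - g x)) FF (eps%:E * L2 Q F)%E).

Definition sup_log_cover (eps : R) : \bar R :=
  ereal_sup [set log_cover Q eps | Q in [set Q : probability T R | finitely_supported Q]].

Lemma le_lne (x y : \bar R) : (x <= y)%E -> (lne x <= lne y)%E.
Proof.
case: x y => [x||] [y||]//=; rewrite ?leey ?leNye// lee_fin => xy.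
case: ifPn => x0; first by rewrite leNye.
rewrite -ltNge in x0; rewrite ifF; last by apply/negbTE; rewrite -ltNge (lt_le_trans x0).
by rewrite lee_fin ler_ln// posrE// (lt_le_trans x0).
Qed.

Lemma covering_number_anti (U : Type) (dist : U -> U -> \bar R) A e1 e2 :
  (e1 <= e2)%E -> (covering_number dist A e2 <= covering_number dist A e1)%E.
Proof.
move=> e12; apply: le_ereal_inf_tmp => _ [k [c [cA cov]] <-].
apply: ereal_inf_lbound; exists k => //; exists c; split => // f Af.
by have [i ci] := cov f Af; exists i; rewrite (le_trans ci).
Qed.

Lemma sup_log_cover_anti e1 e2 : e1 <= e2 -> (sup_log_cover e2 <= sup_log_cover e1)%E.
Proof.
move=> e12; apply: ge_ereal_sup => _ [Q finQ <-].
apply: (@le_trans _ _ (log_cover Q e1)); last by apply: ereal_sup_ubound; exists Q.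
by apply/le_lne/covering_number_anti; rewrite lee_wpmul2r// Lnorm_ge0.
Qed.

(** An infimum of natural numbers is a minimum, so that a finite covering
number comes with a cover of exactly that size. *)
Lemma covering_number_attained (U : Type) (dist : U -> U -> \bar R) (A : set U) eps :
  (covering_number dist A eps < +oo)%E ->
  exists k, covering_number dist A eps = (k%:R)%:E /\
   exists c : 'I_k -> U, (forall i, A (c i)) /\
    forall f, A f -> exists i, (dist (c i) f <= eps)%E.
Proof.
rewrite /covering_number; set S := [set k | _] => Sfin.
have : exists k, `[< S k >].
  apply: contrapT => nS; move: Sfin; rewrite (_ : S = set0) ?image_set0 ?ereal_inf0//.
  by apply/seteqP; split => // k Sk; apply: nS; exists k; apply/asboolP.
move=> exS; case: (ex_minnP exS) => k /asboolP Sk kmin; exists k; split => //.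
apply/eqP; rewrite eq_le; apply/andP; split; first by apply: ereal_inf_lbound; exists k.
apply: le_ereal_inf_tmp => _ [j Sj <-]; rewrite lee_fin ler_nat; apply: kmin; exact/asboolP.
Qed.

Lemma sqrte_le (x y : \bar R) : (x <= y)%E -> (sqrte x <= sqrte y)%E.
Proof.
case: x y => [x||] [y||]//=; rewrite ?leey ?leNye ?lee_fin ?sqrtr_ge0//.
exact: ler_wsqrtr.
Qed.

Lemma entropy_dyadic (K : nat) :
  (\sum_(k < K) (2^-1 ^+ k.+1)%:E * sqrte (1 + sup_log_cover (2^-1 ^+ k)%R) <=
   entropy_integral FF F 1)%E.
Proof.
apply: (@dyadic_sum_le_integral R (fun e => sqrte (1 + sup_log_cover e))) => [x|x y xy].
  exact: sqrte_ge0.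
by apply/sqrte_le/leeD => //; exact: sup_log_cover_anti.
Qed.

Lemma L2E (mu : {measure set T -> \bar R}) (f : T -> R) :
  L2 mu f = sqrte (\int[mu]_x (f x ^+ 2)%:E)%E.
Proof.
rewrite -poweR12_sqrt; last by apply: integral_ge0 => x _; rewrite lee_fin sqr_ge0.
rewrite /L2 unlock; congr (_ `^ _)%E; apply: eq_integral => x _.
by rewrite /= powR_mulrn// real_normK// num_real.
Qed.

Lemma L2_sqr (mu : {measure set T -> \bar R}) (f : T -> R) :
  (L2 mu f ^+ 2 = \int[mu]_x (f x ^+ 2)%:E)%E.
Proof.
by rewrite L2E sqr_sqrte// integral_ge0// => x _; rewrite lee_fin sqr_ge0.
Qed.

End entropy_facts.

Section uniform_on_points.
Context d (U : measurableType d) (R : realType) (x : nat -> U) (n : nat).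

Let w0 : 0 <= n.+1%:R^-1 :> R.
Proof. by rewrite invr_ge0. Qed.

(** The points may repeat and are indexed by [i < n.+1], which makes the total
mass 1 without a positivity hypothesis. *)
Definition uniform_on_points : set U -> \bar R :=
  msum (fun i => mscale (NngNum w0) \d_(x i)) n.+1.

HB.instance Definition _ := Measure.on uniform_on_points.

Lemma uniform_on_pointsE A :
  uniform_on_points A = (\sum_(i < n.+1) (n.+1%:R^-1)%:E * \d_(x i) A)%E.
Proof. by []. Qed.

Let uniform_on_pointsT : uniform_on_points setT = 1%E.
Proof.
rewrite uniform_on_pointsE (eq_bigr (fun=> (n.+1%:R^-1)%:E)); last first.
  by move=> i _; rewrite diracT mule1.
by rewrite sumEFin sumr_const card_ord -[X in X%:E]mulr_natl mulfV// pnatr_eq0.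
Qed.

HB.instance Definition _ :=
  Measure_isProbability.Build _ _ _ uniform_on_points uniform_on_pointsT.

Lemma integral_uniform_on_points (f : U -> R) :
  measurable_fun setT f -> (forall u, 0 <= f u) ->
  (\int[uniform_on_points]_u (f u)%:E =
   (n.+1%:R^-1 * \sum_(i < n.+1) f (x i))%:E)%E.
Proof.
move=> mf f0.
have mf' : measurable_fun setT (EFin \o f) by exact/measurable_EFinP.
rewrite ge0_integral_measure_sum//; last by move=> ? _; rewrite lee_fin.
rewrite (eq_bigr (fun i : 'I_n.+1 => (n.+1%:R^-1 * f (x i))%:E)); last first.
  move=> i _; rewrite ge0_integral_mscale//; last by move=> ? _; rewrite lee_fin.
  by rewrite integral_dirac// diracT mul1e.
by rewrite sumEFin -big_distrr.
Qed.

End uniform_on_points.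

(** The uniform distribution on the selected points is one of the finitely
supported measures over which the entropy takes its supremum. *)
Lemma empirical_measure d (U : measurableType d) (R : realType) (I : finType)
    (z : I -> bool) (y : I -> U) :
  (0 < \sum_t (z t)%:R :> R) ->
  exists Q : probability U R, finitely_supported Q /\
    forall f : U -> R, measurable_fun setT f -> (forall x, 0 <= f x) ->
    (\int[Q]_x (f x)%:E =
     ((\sum_t (z t)%:R)^-1 * \sum_t (z t)%:R * f (y t))%:E)%E.
Proof.
move=> n0; pose s := [seq t <- enum I | z t].
have sums (g : I -> R) : \sum_(t <- s) g t = \sum_t (z t)%:R * g t.
  rewrite big_filter big_enum_cond/= big_mkcond.
  by apply: eq_bigr => t _; case: (z t); rewrite ?mul1r ?mul0r.
have sizes : (size s)%:R = \sum_t (z t)%:R :> R.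
  rewrite -[LHS]mulr_natl mulr1 -sum1_size natr_sum sums.
  by apply: eq_bigr => t _; rewrite mulr1.
have s0 : (0 < size s)%N by rewrite -(ltr_nat R) sizes.
have sS : (size s).-1.+1 = size s by rewrite prednK.
have [t0 _] : exists t, t \in s.
  by case: (s) s0 => // a l _; exists a; rewrite mem_head.
exists (uniform_on_points R (fun i => y (nth t0 s i)) (size s).-1); split.
  exists (size s).-1.+1, (fun i => y (nth t0 s i)), (fun=> (size s).-1.+1%:R^-1).
  by split => // A _; exact: uniform_on_pointsE.
move=> f mf f0; rewrite integral_uniform_on_points// sS sizes -(sums (fun t => f (y t))).
by rewrite (big_nth t0 (r := s)) big_mkord.
Qed.

Section entropy_chaining.
Context d (U : measurableType d) (R : realType) (I : finType) (M : nat).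
Variables (FF : set (U -> R)) (F : U -> R) (y : I -> U) (J : R).
Hypothesis FF0 : FF !=set0.
Hypothesis FF_meas : forall f, FF f -> measurable_fun setT f.
Hypothesis F_meas : measurable_fun setT F.
Hypothesis F_env : forall f x, FF f -> `|f x| <= F x.
Hypothesis I0 : (0 < #|I|)%N.
Hypothesis M0 : (0 < M)%N.
Hypothesis FJ : entropy_integral FF F 1 = J%:E.

Let dy (k : nat) : R := 2^-1 ^+ k.

Lemma covering_number_ge1 (dist : (U -> R) -> (U -> R) -> \bar R) eps :
  (1 <= covering_number dist FF eps)%E.
Proof.
apply: le_ereal_inf_tmp => _ [k [c [_ cov]] <-].
have [f Ff] := FF0; have [i _] := cov f Ff.
by rewrite lee_fin ler1n (leq_ltn_trans _ (ltn_ord i)).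
Qed.

(** The supremum over the measures is not over an empty set, as a point [y t]
exists, and a nonempty class has covering numbers at least 1. *)
Lemma sup_log_cover_ge0 eps : (0 <= sup_log_cover FF F eps)%E.
Proof.
have n0 : 0 < \sum_(t : I) (true%:R : R).
  by rewrite sumr_const -mulr_natl mulr1 ltr0n.
have [Q [Qfin _]] := empirical_measure y n0.
apply: (@le_trans _ _ (log_cover FF F Q eps)); last by apply: ereal_sup_ubound; exists Q.
by rewrite lne_ge0 covering_number_ge1.
Qed.

(** An infinite entropy at a scale [2^-k] would persist on all smaller scales
and make the integral infinite. *)
Lemma sup_log_cover_fin k : exists2 h : R, 0 <= h & sup_log_cover FF F (dy k) = h%:E.
Proof.
have h0 := sup_log_cover_ge0 (dy k).
have : (sup_log_cover FF F (dy k) < +oo)%E.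
  rewrite ltNge leye_eq; apply/negP => /eqP hoo.
  have := entropy_dyadic FF F k.+1; rewrite FJ big_ord_recr/= -/(dy k) hoo/=.
  rewrite gt0_muley ?lte_fin ?exprn_gt0//.
  rewrite addey ?leye_eq// -ltNye (lt_le_trans (ltNyr 0))// sume_ge0// => i _.
  by rewrite mule_ge0 ?sqrte_ge0// lee_fin exprn_ge0.
move: h0; case: (sup_log_cover _ _ _) => // h h0 _; exists h => //.
Qed.

Lemma L2_empirical (Q : probability U R) (z : I -> bool) (n : R) (f : U -> R) :
  (forall g : U -> R, measurable_fun setT g -> (forall x, 0 <= g x) ->
    (\int[Q]_x (g x)%:E = (n^-1 * \sum_t (z t)%:R * g (y t))%:E)%E) ->
  measurable_fun setT f ->
  L2 Q f = (Num.sqrt (n^-1 * \sum_t (z t)%:R * f (y t) ^+ 2))%:E.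
Proof.
move=> QE mf; rewrite L2E QE//; last by move=> x; rewrite sqr_ge0.
exact: measurable_funX.
Qed.

(** At the scale [2^-k] an optimal cover for the uniform distribution on the
selected points is a cover for the seminorm of the selected coordinates, since
the two differ by the normalization only. The bound [truncn (expR h)] on its
size is the same for all selections. *)
Lemma cover_points (z : I -> bool) k h : sup_log_cover FF F (dy k) = h%:E ->
  exists c : nat -> I -> R, forall f, FF f -> exists2 i, (i < Num.truncn (expR h))%N &
    \sum_t (z t)%:R * (f (y t) - c i t) ^+ 2 <=
    4^-1 ^+ k * \sum_t (z t)%:R * F (y t) ^+ 2.
Proof.
move=> hE; have h0 : 0 <= h by rewrite -lee_fin -hE sup_log_cover_ge0.
set n : R := \sum_t (z t)%:R.
have [n0|n0] := leP n 0.
  have zt t : (z t)%:R = 0 :> R.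
    apply/eqP; rewrite eq_le ler0n andbT; apply: le_trans n0.
    by rewrite /n (bigD1 t)//= lerDl sumr_ge0.
  (* Nothing is selected, and the seminorm vanishes. *)
  exists (fun _ _ => 0) => f _; exists 0%N.
    by rewrite truncn_gt0 -[leLHS]expR0 ler_expR.
  by rewrite !big1 ?mulr0// => t _; rewrite zt mul0r.
have [Q [Qfin QE]] := empirical_measure y n0.
have lch : (log_cover FF F Q (dy k) <= h%:E)%E.
  by rewrite -hE; apply: ereal_sup_ubound; exists Q.
have covfin : (covering_number (fun f g : U -> R => L2 Q (fun x => (f x - g x)%R)) FF
    ((dy k)%:E * L2 Q F)%E < +oo)%E.
  rewrite ltNge leye_eq; apply/negP => /eqP cy.
  by move: lch; rewrite /log_cover cy.
have [m [mE [c [cF cov]]]] := covering_number_attained covfin.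
have m0 : (0 < m)%N.
  by have [f Ff] := FF0; have [i _] := cov f Ff; exact: leq_ltn_trans (ltn_ord i).
have mh : (m <= Num.truncn (expR h))%N.
  rewrite truncn_ge_nat ?expR_ge0// -ler_ln ?posrE ?ltr0n ?expR_gt0//.
  by rewrite expRK -lee_fin -lne_EFin ?ltr0n// -mE.
exists (fun i t => if insub i is Some j then c j (y t) else 0) => f Ff.
have [i ci] := cov f Ff; exists i; first exact: leq_trans (ltn_ord i) mh.
have n1 : 0 < n^-1 by rewrite invr_gt0.
rewrite valK.
have mcf : measurable_fun setT (fun x => c i x - f x).
  by apply: measurable_funB; exact: FF_meas.
move: ci; rewrite (L2_empirical QE mcf) (L2_empirical QE F_meas) -EFinM lee_fin.
have d0 : 0 <= dy k by rewrite exprn_ge0// invr_ge0.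
rewrite -ler_sqr ?nnegrE ?sqrtr_ge0 ?mulr_ge0 ?sqrtr_ge0//.
have S0 (g : I -> R) : 0 <= n^-1 * \sum_t (z t)%:R * g t ^+ 2.
  by rewrite mulr_ge0 ?(ltW n1)// sumr_ge0// => t _; rewrite mulr_ge0 ?sqr_ge0.
rewrite exprMn !sqr_sqrtr// mulrCA ler_pM2l// /dy -exprM mulnC exprM.
have -> : 2^-1 ^+ 2 = 4^-1 :> R by field.
apply: le_trans; rewrite le_eqVlt; apply/orP; left; apply/eqP.
by apply: eq_bigr => t _; rewrite -sqrrN opprB.
Qed.

(** The chaining bound with all the covers taken from the entropy integral.
The level 0 of the chain is the zero vector, so that the scale [2^-k] is used at
the level [k + 1]; the factor 2 in [2 * J] is the ratio of [2^-k] to the length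
of the dyadic interval ending there. *)
Lemma entropy_chaining (z : 'I_M * I -> bool) :
  exists2 V : {ffun 'I_M * I -> bool} -> R,
    forall e m f, [set (fun t => f (y t)) | f in FF] f ->
      masked_sum z m f e ^+ 2 <= V e &
    rad_mean V <= 80 * 81 * ln (2 * M)%:R * (2 * J) ^+ 2 *
      \big[Num.max/0]_(m < M) masked_sqnorm z m (F \o y).
Proof.
set s := \big[_/_]_(m < M) _.
have s0 : 0 <= s by exact: bigmax_ge_id.
have sm m : masked_sqnorm z m (F \o y) <= s by rewrite /s (bigmax_sup m).
have /choice[h hP] : forall k, exists h : R, 0 <= h /\ sup_log_cover FF F (dy k) = h%:E.
  by move=> k; have [h ? ?] := sup_log_cover_fin k; exists h.
have h_nd k : h k <= h k.+1.
  rewrite -lee_fin -(hP k).2 -(hP k.+1).2; apply: sup_log_cover_anti.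
  by rewrite /dy exprS ler_piMl ?exprn_ge0 ?invr_ge0// invf_le1//; lra.
have /choice[c cP] : forall mk : 'I_M * nat, exists c : nat -> I -> R,
    forall f, FF f -> exists2 i, (i < Num.truncn (expR (h mk.2)))%N &
    \sum_t (z (mk.1, t))%:R * (f (y t) - c i t) ^+ 2 <=
    4^-1 ^+ mk.2 * \sum_t (z (mk.1, t))%:R * F (y t) ^+ 2.
  by move=> [m k]; apply: cover_points; exact: (hP k).2.
pose nu k := if k is k'.+1 then Num.truncn (expR (h k')) else 1%N.
pose c' m k i := if k is k'.+1 then c (m, k') i else fun=> 0.
have nu1 k : (0 < nu k.+1)%N by rewrite /= truncn_gt0 -[leLHS]expR0 ler_expR (hP k).1.
have [V VA VE] : exists2 V : {ffun 'I_M * I -> bool} -> R,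
    forall e m f, [set (fun t => f (y t)) | f in FF] f ->
      masked_sum z m f e ^+ 2 <= V e &
    rad_mean V <= 80 * 81 * ln (2 * M)%:R * s * (2 * J) ^+ 2.
  apply: (@chaining _ _ _ z _ s (2 * J) c' nu (fun k => Num.sqrt (1 + h k))) => //.
  - by case=> [//|k]; exact: nu1.
  - case=> [|k]; first exact: nu1.
    by apply: le_truncn; rewrite ler_expR.
  - move=> k; rewrite sqr_sqrtr; last by have := (hP k).1; lra.
    rewrite lerD2l -ler_expR lnK ?posrE ?ltr0n ?nu1//.
    by rewrite truncn_le expR_ge0.
  - move=> m [|k] _ [f Ff <-].
      exists 0%N => //=; rewrite expr0 mulr1; apply: (@le_trans _ _ s); last by lra.
      apply: le_trans (sm m); apply: ler_sum => t _ /=; rewrite subr0 ler_wpM2l//.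
      rewrite -real_normK ?num_real// ler_sqr ?nnegrE// ?F_env//.
      by apply: le_trans (F_env _ Ff).
    have [i ik H] := cP (m, k) f Ff; exists i => //=; apply: le_trans H _ => /=.
    rewrite exprS (mulrA 4) divff// mul1r ler_wpM2l ?exprn_ge0 ?invr_ge0//.
    exact: sm.
  - move=> K; have := entropy_dyadic FF F K; rewrite FJ.
    rewrite (eq_bigr (fun k : 'I_K => (2^-1 * (2^-1 ^+ k * Num.sqrt (1 + h k)))%:E)).
      by rewrite sumEFin -big_distrr lee_fin/=; lra.
    by move=> k _; rewrite -/(dy k) (hP k).2/= exprS mulrA.
by exists V => //; apply: le_trans VE _; rewrite mulrAC.
Qed.

End entropy_chaining.

(** * Laws of subsamples *)

Section box.
Context d (S : measurableType d) (R : realType).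

Definition box k (A : 'I_k -> set S) : set (k.-tuple S) :=
  [set x | forall i, A i (tnth x i)].

Lemma measurable_box k (A : 'I_k -> set S) :
  (forall i, measurable (A i)) -> measurable (box A).
Proof.
move=> mA; rewrite (_ : box A = \bigcap_(i in [set: 'I_k]) ((fun x => tnth x i) @^-1` A i)).
  apply: fin_bigcap_measurable; first exact: finite_finset.
  by move=> i _; rewrite -[X in measurable X]setTI; exact: measurable_tnth.
by apply/seteqP; split => x /= H i; [move=> _|]; exact: H.
Qed.

(** Boxes are stable under intersection and generate the product
sigma-algebra. *)
Lemma probability_box_unique k (P Q : probability (k.-tuple S) R) :
  (forall A : 'I_k -> set S, (forall i, measurable (A i)) -> P (box A) = Q (box A)) ->
  forall B, measurable B -> P B = Q B.
Proof.
move=> PQ B mB.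
pose G := [set B : set (k.-tuple S) | exists2 A : 'I_k -> set S,
  (forall i, measurable (A i)) & B = box A].
apply: (measure_unique G (fun=> setT)) => //.
- apply/seteqP; split.
    rewrite /measurable/=; apply: smallest_sub; first exact: smallest_sigma_algebra.
    move=> D; rewrite -bigcup_seq => -[i _ [A mA <-]]; apply: sub_sigma_algebra.
    exists (fun j => if j == i then A else setT) => [j|]; first by case: ifP.
    rewrite setTI; apply/seteqP; split => x /=.
      by move=> Ax j; case: eqP => [->|].
    by move=> /(_ i); rewrite eqxx.
  apply: smallest_sub; first exact: sigma_algebra_measurable.
  by move=> D [A mA ->]; exact: measurable_box.
- move=> _ _ [A mA ->] [A' mA' ->]; exists (fun i => A i `&` A' i).
    by move=> i; exact: measurableI.
  apply/seteqP; split => x /=; first by move=> [a b] i; split; [exact: a|exact: b].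
  by move=> H; split => i; have [] := H i.
- by move=> _; exists (fun=> setT) => //; apply/seteqP; split.
- by rewrite bigcup_const//; exists 0%N.
- by move=> _ [A mA ->]; exact: PQ.
- by move=> _; rewrite (le_lt_trans (probability_le1 P _))// ltry.
Qed.

Lemma power_probability_box (P : probability S R) k (A : 'I_k -> set S) :
  (forall i, measurable (A i)) ->
  power_probability P k (box A) = (\prod_(i < k) P (A i))%E.
Proof.
elim: k A => [|k IH] A mA.
  rewrite big_ord0/= diracE mem_set//= => i; by case: i.
rewrite big_ord_recl/= /distribution/= /pushforward.
pose A' (i : 'I_k) := A (lift ord0 i).
have -> : @tuple_of_pair S k @^-1` box A = A ord0 `*` box A'.
  apply/seteqP; split => -[x y]/=.
    move=> H; split; first exact: (H ord0).
    by move=> i; have := H (lift ord0 i); rewrite tnthS.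
  by move=> [/= Ax Ay] i; case: (unliftP ord0 i) => [j ->|->]; rewrite ?tnthS//; exact: Ay.
rewrite product_measure1E//; last by apply: measurable_box => i; exact: mA.
by congr (_ * _)%E; apply: IH => i; exact: mA.
Qed.

End box.

Section law_of_subsample.
Context d (S : measurableType d) (R : realType) (P : probability S R).
Context dO (Omega : measurableType dO) (Pr : probability Omega R) (n : nat).
Variable X : 'I_n -> {RV Pr >-> S}.
Hypothesis X_law : forall i A, measurable A -> distribution Pr (X i) A = P A.
Hypothesis X_indep : mutually_independent X.

Lemma measurable_subdata k (t : 'I_k -> 'I_n) :
  measurable_fun setT (fun w => [tuple X (t i) w | i < k]).
Proof.
apply/measurable_fun_tnthP => i.
rewrite (_ : _ \o _ = X (t i)); last by apply/funext => w; rewrite /= tnth_mktuple.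
exact: measurable_funP.
Qed.

(** As the indices are distinct, the event that the chosen coordinates lie in a
box is a product event for the whole sample, with no constraint on the other
coordinates. *)
Lemma subdata_law k (t : 'I_k -> 'I_n) : injective t ->
  forall B : set (k.-tuple S), measurable B ->
  Pr ((fun w => [tuple X (t i) w | i < k]) @^-1` B) = power_probability P k B.
Proof.
move=> t_inj.
pose Y : {RV Pr >-> k.-tuple S} :=
  HB.pack (fun w => [tuple X (t i) w | i < k])
    (isMeasurableFun.Build _ _ _ _ _ (measurable_subdata t)).
apply: (@probability_box_unique _ _ _ _ (distribution Pr Y)) => A mA.
rewrite power_probability_box//.
pose B i : set S := [set s | forall k, t k = i -> A k s].
have BtE j : B (t j) = A j.
  apply/seteqP; split => s /=; first by move=> /(_ j erefl).
  by move=> As j' /t_inj ->.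
have mB i : measurable (B i).
  have [[j <-]|ni] := pselect (exists j, t j = i); first by rewrite BtE.
  rewrite (_ : B i = setT)//; apply/seteqP; split => s //= _ j tj.
  by exfalso; apply: ni; exists j.
transitivity (Pr (\bigcap_(i in [set: 'I_n]) X i @^-1` B i)).
  congr (Pr _); apply/seteqP; split => w /=.
    by move=> H i _ j tj; have := H j; rewrite tnth_mktuple tj.
  by move=> H j; rewrite tnth_mktuple; apply: (H (t j) I j erefl).
rewrite X_indep//.
transitivity (\prod_(i : 'I_n) P (B i))%E.
  by apply: eq_bigr => i _; exact: X_law.
rewrite (bigID (fun i => i \in codom t))/= [X in (_ * X)%E]big1 ?mule1; last first.
  move=> i ni; rewrite (_ : B i = setT) ?probability_setT//.
  apply/seteqP; split => s //= _ j tj; exfalso; move/negP: ni; apply.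
  by rewrite -tj codom_f.
rewrite -big_uniq/=; last by rewrite /codom /image_mem map_inj_uniq ?enum_uniq.
rewrite /codom /image_mem big_map big_enum/=.
by apply: eq_bigr => j _; rewrite BtE.
Qed.

End law_of_subsample.

(** * Integrating out the selection *)

Section independence_integral.
Context dO (Omega : measurableType dO) (R : realType) (mu : {measure set Omega -> \bar R}).

Lemma integral_mrestr (E : set Omega) (mE : measurable E) (f : Omega -> \bar R) :
  measurable_fun setT f -> (forall w, (0 <= f w)%E) ->
  (\int[mrestr mu mE]_w f w = \int[mu]_(w in E) f w)%E.
Proof.
move=> mf f0; rewrite -(setUv E) ge0_integral_setU//; last 3 first.
- exact: measurableC.
- by rewrite setUv.
- by apply/disj_setPS; rewrite setICr.
rewrite [X in (_ + X)%E](_ : _ = 0%E) ?adde0.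
  by apply: eq_measure_integral => A mA AE; rewrite /= /mrestr setIidl//.
rewrite -(integral_measure_zero (~` E) f).
apply: eq_measure_integral => A mA AE; rewrite /= /mrestr /mzero.
rewrite (_ : A `&` E = set0) ?measure0//.
by apply/seteqP; split => w //= -[Aw Ew]; exact: (AE w).
Qed.

(** The image under [Y] of the restriction of [mu] to [E] is [a] times the
image of [mu]. *)
Lemma integral_indep_event d' (T : measurableType d') (Y : Omega -> T)
    (E : set Omega) (h : T -> \bar R) (a : R) :
  measurable_fun setT Y -> measurable E -> (0 <= a) ->
  (forall B, measurable B -> mu (Y @^-1` B `&` E) = (a%:E * mu (Y @^-1` B))%E) ->
  measurable_fun setT h -> (forall x, (0 <= h x)%E) ->
  (\int[mu]_w ((\1_E w)%:E * h (Y w)) = a%:E * \int[mu]_w h (Y w))%E.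
Proof.
move=> mY mE a0 indep mh h0.
have mhY : measurable_fun setT (h \o Y) by exact: measurableT_comp.
have -> : (\int[mu]_w ((\1_E w)%:E * h (Y w)) = \int[mu]_(w in E) h (Y w))%E.
  rewrite [RHS]integral_mkcond; apply: eq_integral => w _.
  rewrite patchE indicE; case: ifPn => _; by rewrite ?mul1e ?mul0e.
rewrite -(integral_mrestr mE)//.
have push (m : {measure set Omega -> \bar R}) :
    (\int[m]_w h (Y w) = \int[pushforward m Y]_y h y)%E.
  by rewrite ge0_integral_pushforward.
pose mYX := isMeasurableFun.Build _ _ _ _ _ mY.
pose Y' : {mfun Omega >-> T} := HB.pack Y mYX.
rewrite !push.
have -> : a = (NngNum a0)%:num by [].
rewrite -(@ge0_integral_mscale _ _ _ (pushforward mu Y') setT)//.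
apply: eq_measure_integral => B mB _.
by rewrite /= /pushforward /= /mrestr indep.
Qed.

End independence_integral.

Section conditioning.
Context d (S : measurableType d) (R : realType).
Context dO (Omega : measurableType dO) (Pr : probability Omega R) (n : nat) (J : finType).
Variables (X : 'I_n -> {RV Pr >-> S}) (Z : J -> {RV Pr >-> bool}) (p : R).
Hypothesis p01 : 0 <= p <= 1.
Hypothesis Z_law : forall j A, distribution Pr (Z j) A = bernoulli_prob p A.
Hypothesis Z_indep : mutually_independent Z.
Hypothesis XZ_indep : independent_families X Z.

Definition sample w := [tuple X i w | i < n].
Definition selection_at w : {ffun J -> bool} := [ffun j => Z j w].

Let E (z : {ffun J -> bool}) := \bigcap_(j in [set: J]) Z j @^-1` [set z j].

Lemma measurable_sample : measurable_fun setT sample.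
Proof. exact: (@measurable_subdata _ _ _ _ _ _ _ _ _ id). Qed.

Lemma sigma_generated_selection z : sigma_generated Z (E z).
Proof.
rewrite /sigma_generated; set G := [set _ | _].
have : measurable (E z : set (g_sigma_algebraType G)).
  apply: fin_bigcap_measurable; first exact: finite_finset.
  by move=> j _; apply: sub_sigma_algebra; exists j, [set z j].
by [].
Qed.

(** Equivalently, the sample is measurable from the sigma-algebra generated by
the [X i], which is checked coordinate by coordinate. *)
Lemma sigma_generated_sample B : measurable B -> sigma_generated X (sample @^-1` B).
Proof.
move=> mB; rewrite /sigma_generated; set G := [set _ | _].
have mX : measurable_fun [set: g_sigma_algebraType G]
    (sample : g_sigma_algebraType G -> n.-tuple S).
  apply/measurable_fun_tnthP => i.
  rewrite (_ : _ \o _ = X i); last by apply/funext => w; rewrite /= tnth_mktuple.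
  by move=> _ A mA; rewrite setTI; apply: sub_sigma_algebra; exists i, A.
by have := mX measurableT B mB; rewrite setTI.
Qed.

Lemma measurable_selection_event z : measurable (E z).
Proof.
apply: fin_bigcap_measurable; first exact: finite_finset.
by move=> j _; rewrite -[X in measurable X]setTI; exact: measurable_funP.
Qed.

Lemma probability_selection_event z : Pr (E z) = (bern_weight p z)%:E.
Proof.
rewrite Z_indep// /bern_weight -prodEFin; apply: eq_bigr => j _.
rewrite -[LHS]/(distribution Pr (Z j) [set z j]) Z_law bernoulli_probE//.
rewrite /bern_prob !diracE; case: (z j).
  by rewrite mem_set// memNset// mule1 mule0 adde0.
by rewrite memNset// mem_set// mule1 mule0 add0e.
Qed.

(** Fubini's theorem for the pair (selection, sample): the space is split
according to the finitely many values of the selection. *)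
Lemma integral_selection (H : {ffun J -> bool} -> n.-tuple S -> \bar R) :
  (forall z, measurable_fun setT (H z)) -> (forall z x, (0 <= H z x)%E) ->
  (\int[Pr]_w H (selection_at w) (sample w) =
   \sum_z (bern_weight p z)%:E * \int[Pr]_w H z (sample w))%E.
Proof.
move=> mH H0.
have mHd z : measurable_fun setT (fun w => H z (sample w)).
  exact: (measurableT_comp (mH z) measurable_sample).
have mI z : measurable_fun setT (fun w => (\1_(E z) w)%:E : \bar R).
  by apply/measurable_EFinP; apply: measurable_indic; exact: measurable_selection_event.
transitivity (\int[Pr]_w \sum_z ((\1_(E z) w)%:E * H z (sample w)))%E.
  apply: eq_integral => w _; rewrite (bigD1 (selection_at w))//= big1 ?adde0.
    rewrite indicE mem_set ?mul1e// => j _; by rewrite /= ffunE.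
  move=> z zw; rewrite indicE memNset ?mul0e// => Ez.
  by move/eqP: zw; apply; apply/ffunP => j; rewrite ffunE (Ez j).
rewrite ge0_integral_sum//; first last.
- by move=> z w _; rewrite mule_ge0// lee_fin.
- by move=> z; apply: emeasurable_funM.
apply: eq_bigr => z _; apply: integral_indep_event => //.
- exact: measurable_sample.
- exact: measurable_selection_event.
- exact: bern_weight_ge0.
- move=> B mB.
  have := XZ_indep (sigma_generated_sample mB) (sigma_generated_selection z).
  by rewrite probability_selection_event muleC.
Qed.

End conditioning.

Section measurable_max.
Context d (T : measurableType d) (R : realType).

Lemma measurable_bigmaxe (I : Type) (s : seq I) (f : I -> T -> \bar R) :
  (forall i, measurable_fun setT (f i)) ->
  measurable_fun setT (fun x => \big[maxe/0%E]_(i <- s) f i x).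
Proof.
move=> mf; elim: s => [|a s IH].
  rewrite (_ : (fun _ => _) = cst 0%E) //; apply/funext => x; exact: big_nil.
rewrite (_ : (fun _ => _) = fun x => maxe (f a x) (\big[maxe/0%E]_(i <- s) f i x)).
  exact: measurable_maxe.
by apply/funext => x; rewrite big_cons.
Qed.

Lemma measurable_bigmaxr (I : Type) (s : seq I) (f : I -> T -> R) :
  (forall i, measurable_fun setT (f i)) ->
  measurable_fun setT (fun x => \big[Num.max/0]_(i <- s) f i x).
Proof.
move=> mf; elim: s => [|a s IH].
  rewrite (_ : (fun _ => _) = cst 0) //; apply/funext => x; exact: big_nil.
rewrite (_ : (fun _ => _) = fun x => Num.max (f a x) (\big[Num.max/0]_(i <- s) f i x)).
  exact: measurable_maxr.
by apply/funext => x; rewrite big_cons.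
Qed.

End measurable_max.

(** * The bound given the data, and its integral *)

Section pointwise.
Context d (S : measurableType d) (R : realType) (n r M N : nat).
Variables (FF : set (r.-tuple S -> R)) (F : r.-tuple S -> R) (J : R).
Hypothesis FF0 : FF !=set0.
Hypothesis FF_meas : forall f, FF f -> measurable_fun setT f.
Hypothesis F_meas : measurable_fun setT F.
Hypothesis F_env : forall f x, FF f -> `|f x| <= F x.
Hypothesis M0 : (0 < M)%N.
Hypothesis N0 : (0 < N <= #|index_set n r|)%N.
Hypothesis FJ : entropy_integral FF F 1 = J%:E.

Notation I := (index_set n r).
Notation selection := {ffun 'I_M * I -> bool}.
Let p : R := sampling_prob R n r N.
Let ell : R := ln (2 * M)%:R.

Lemma sampling_prob01 : 0 <= p <= 1.
Proof.
have /andP[N1 NI] := N0.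
have I0 : 0 < #|I|%:R :> R by rewrite ltr0n (leq_trans N1).
apply/andP; split; first by rewrite divr_ge0.
by rewrite /p /sampling_prob ler_pdivrMr// mul1r ler_nat.
Qed.

Definition max_sup_norm_sqr (z : selection) (x : n.-tuple S) : \bar R :=
  (\big[maxe/0]_(m < M)
    (sup_norm FF (selection_process N x (fun t => z (m, t))) ^+ 2))%E.

Definition max_selected_at (z : selection) (x : n.-tuple S) : R :=
  max_selected F x (fun m t => z (m, t)).

Let A (x : n.-tuple S) : set (I -> R) := [set (fun t => f (subsample x t)) | f in FF].

Lemma max_sup_norm_sqr_le (z : selection) x :
  (max_sup_norm_sqr z x <= (N%:R^-1 * sup_quadratic (A x) (fun j => (z j)%:R - p))%:E)%E.
Proof.
have /andP[N1 _] := N0.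
set Q := sup_quadratic _ _.
have Qub (m : 'I_M) f : FF f ->
    (\sum_t f (subsample x t) * ((z (m, t))%:R - p)) ^+ 2 <= Q.
  move=> Ff.
  apply: (@sup_quadratic_ub _ _ _ (A x) (fun t => F (subsample x t)) _
    (fun j => (z j)%:R - p) m (fun t => f (subsample x t))); last by exists f.
  by move=> _ t [g Fg <-]; exact: F_env.
have Q0 : 0 <= Q.
  by have [f Ff] := FF0; apply: le_trans (Qub (Ordinal M0) f Ff); rewrite sqr_ge0.
have NQ0 : 0 <= N%:R^-1 * Q by rewrite mulr_ge0// invr_ge0.
apply: bigmax_le => [|m _]; first by rewrite lee_fin.
have sup_le : (sup_norm FF (selection_process N x (fun t => z (m, t))) <=
    (Num.sqrt (N%:R^-1 * Q))%:E)%E.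
  apply: ge_ereal_sup => _ [->|[f Ff <-]]; first by rewrite lee_fin sqrtr_ge0.
  rewrite lee_fin -ler_sqr ?nnegrE// sqr_sqrtr// real_normK ?num_real//.
  rewrite /selection_process exprMn exprVn sqr_sqrtr// ler_wpM2l ?invr_ge0//.
  apply: le_trans (Qub m f Ff); rewrite le_eqVlt; apply/orP; left; apply/eqP.
  by congr (_ ^+ 2); apply: eq_bigr => t _; rewrite mulrC.
have sup0 : (0 <= sup_norm FF (selection_process N x (fun t => z (m, t))))%E.
  by apply: ereal_sup_ubound; left.
rewrite expe2; apply: le_trans (lee_pmul sup0 sup0 sup_le sup_le) _.
by rewrite -EFinM -expr2 sqr_sqrtr.
Qed.

(** Symmetrization, chaining and the self-bounding estimate combined;
[p / N = 1 / #|I|] turns the sum of [F ^+ 2] into its average over the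
subsamples. *)
Lemma conditional_mean_bound x :
  (\sum_z (bern_weight p z)%:E * max_sup_norm_sqr z x <=
   (4 * (80 * 81 * ell * (2 * J) ^+ 2) *
     (2 * (#|I|%:R^-1 * \sum_t F (subsample x t) ^+ 2)))%:E +
   (4 * (80 * 81 * ell * (2 * J) ^+ 2) * (4 * 80 * ell * N%:R^-1))%:E *
     \sum_z (bern_weight p z)%:E * (max_selected_at z x ^+ 2)%:E)%E.
Proof.
have p01 := sampling_prob01.
have /andP[N1 NI] := N0.
have I0 : (0 < #|I|)%N by exact: leq_trans NI.
have F0 y : 0 <= F y.
  by have [f Ff] := FF0; apply: le_trans (F_env y Ff).
have Nn0 : 0 <= N%:R^-1 :> R by rewrite invr_ge0.
apply: (@le_trans _ _ (\sum_z (bern_weight p z)%:E *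
    (N%:R^-1 * sup_quadratic (A x) (fun j => (z j)%:R - p))%:E)%E).
  apply: lee_sum => z _; rewrite lee_wpmul2l ?lee_fin ?bern_weight_ge0//.
  exact: max_sup_norm_sqr_le.
under eq_bigr do rewrite -EFinM.
rewrite [X in (_ + _ * X)%E](eq_bigr
  (fun z => (bern_weight p z * max_selected_at z x ^+ 2)%:E)); last by [].
rewrite !sumEFin -EFinM -EFinD lee_fin.
rewrite -/(bern_mean p (fun z => N%:R^-1 * sup_quadratic (A x) (fun j => (z j)%:R - p))).
rewrite -/(bern_mean p (fun z => max_selected_at z x ^+ 2)) bern_meanZ.
have A0 : A x !=set0 by have [f Ff] := FF0; exists (fun t => f (subsample x t)); exists f.
have AF f t : A x f -> `|f t| <= F (subsample x t).
  by move=> [g Fg <-]; exact: F_env.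
have top0 z : 0 <= max_selected_at z x by exact: bigmax_ge_id.
have ztop (z : selection) m t : (z (m, t))%:R * F (subsample x t) ^+ 2 <= max_selected_at z x ^+ 2.
  have : (z (m, t))%:R * F (subsample x t) <= max_selected_at z x.
    rewrite /max_selected_at /max_selected (bigmax_sup m)// (bigmax_sup t)//.
  have := F0 (subsample x t); have := top0 z.
  case: (z _) => /=; nra.
have ell0 : 0 <= ell by rewrite /ell ln_ge0// ler1n muln_gt0.
set K := 80 * 81 * ell * (2 * J) ^+ 2.
have k0 : 0 <= K by apply: mulr_ge0; [rewrite mulr_ge0|exact: sqr_ge0].
have chain (z : selection) : exists2 V : selection -> R,
    forall e m f, A x f -> masked_sum z m f e ^+ 2 <= V e &
    rad_mean V <= K * \big[Num.max/0]_(m < M) masked_sqnorm z m (fun t => F (subsample x t)).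
  exact: (entropy_chaining (subsample x) FF0 FF_meas F_meas F_env I0 M0 FJ z).
have H : bern_mean p (fun z : selection => sup_quadratic (A x) (fun j => (z j)%:R - p)) <=
    4 * K * (2 * (p * \sum_t F (subsample x t) ^+ 2) +
      4 * 80 * ell * bern_mean p (fun z => max_selected_at z x ^+ 2)).
  exact: (bern_mean_sup_quadratic p01 M0 A0 AF k0 (fun z => sqr_ge0 _) ztop chain).
move: H.
set a := \sum_t _; set b := bern_mean _ (fun z => max_selected_at z x ^+ 2); set q := bern_mean _ _.
move=> H.
apply: le_trans (ler_wpM2l Nn0 H) _; rewrite le_eqVlt; apply/orP; left; apply/eqP.
rewrite /p /sampling_prob; clearbody a b q K ell.
field.
by rewrite !pnatr_eq0 -!lt0n I0 N1.
Qed.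

End pointwise.

Section integrated_bound.
Context d (S : measurableType d) (R : realType) (n r M N : nat).
Context dO (Omega : measurableType dO) (Pr : probability Omega R) (P : probability S R).
Variable X : 'I_n -> {RV Pr >-> S}.
Hypothesis X_law : forall i A, measurable A -> distribution Pr (X i) A = P A.
Hypothesis X_indep : mutually_independent X.
Variable Z : 'I_M * index_set n r -> {RV Pr >-> bool}.
Hypothesis Z_law : forall j A,
  distribution Pr (Z j) A = bernoulli_prob (sampling_prob R n r N) A.
Hypothesis Z_indep : mutually_independent Z.
Hypothesis XZ_indep : independent_families X Z.
Variables (FF : set (r.-tuple S -> R)) (F : r.-tuple S -> R) (J : R).
Hypothesis FF0 : FF !=set0.
Hypothesis FF_meas : forall f, FF f -> measurable_fun setT f.
Hypothesis FF_sup : measurable_sup n N FF.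
Hypothesis F_meas : measurable_fun setT F.
Hypothesis F_env : forall f x, FF f -> `|f x| <= F x.
Hypothesis M0 : (0 < M)%N.
Hypothesis N0 : (0 < N <= #|index_set n r|)%N.
Hypothesis FJ : entropy_integral FF F 1 = J%:E.

Notation I := (index_set n r).
Let ell : R := ln (2 * M)%:R.
Let K : R := 4 * (80 * 81 * ell * (2 * J) ^+ 2).

Lemma measurable_subsample (t : I) :
  measurable_fun setT (fun x : n.-tuple S => subsample x t).
Proof.
apply/measurable_fun_tnthP => k.
rewrite (_ : _ \o _ = fun x => tnth x (tnth (val t) k)); first exact: measurable_tnth.
by apply/funext => x; rewrite /= tnth_mktuple.
Qed.

Lemma index_set_inj (t : I) : injective (tnth (val t)).
Proof.
apply/tuple_uniqP; rewrite -(map_inj_uniq val_inj).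
exact: (sorted_uniq ltn_trans ltnn (valP t)).
Qed.

(** A subsample along an increasing index tuple has law [P^r]. *)
Lemma integral_subsample (t : I) (g : r.-tuple S -> R) :
  measurable_fun setT g -> (forall y, 0 <= g y) ->
  (\int[Pr]_w (g (subsample (sample X w) t))%:E = \int[power_probability P r]_y (g y)%:E)%E.
Proof.
move=> mg g0.
have mY := measurable_subdata X (tnth (val t)).
rewrite (eq_integral (fun w => (EFin \o g) [tuple X (tnth (val t) k) w | k < r])); last first.
  move=> w _ /=; congr (g _)%:E; apply: eq_from_tnth => k.
  by rewrite !tnth_mktuple.
pose Y : {RV Pr >-> r.-tuple S} := HB.pack (fun w => [tuple X (tnth (val t) k) w | k < r])
    (isMeasurableFun.Build _ _ _ _ _ mY).
rewrite -(@ge0_integral_distribution _ _ _ _ _ Pr Y (EFin \o g)); first last.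
- by move=> y; rewrite lee_fin.
- exact/measurable_EFinP.
apply: eq_measure_integral => B mB _.
exact: (subdata_law X_law X_indep (@index_set_inj t)).
Qed.

Lemma measurable_max_selected (z : {ffun 'I_M * I -> bool}) :
  measurable_fun setT (max_selected_at F z : n.-tuple S -> R).
Proof.
apply: measurable_bigmaxr => m; apply: measurable_bigmaxr => t.
apply: measurable_funM => //.
exact: (measurableT_comp F_meas (measurable_subsample t)).
Qed.

Lemma measurable_max_sup_norm_sqr (z : {ffun 'I_M * I -> bool}) :
  measurable_fun setT (max_sup_norm_sqr N FF z).
Proof.
apply: measurable_bigmaxe => m.
under eq_fun do rewrite expe2.
by apply: emeasurable_funM; exact: FF_sup.
Qed.

Lemma max_sup_norm_sqr_ge0 (z : {ffun 'I_M * I -> bool}) (x : n.-tuple S) :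
  (0 <= max_sup_norm_sqr N FF z x)%E.
Proof. exact: bigmax_ge_id. Qed.

Lemma integrated_bound :
  (\int[Pr]_w max_sup_norm_sqr N FF (selection_at Z w) (sample X w) <=
   (2 * K)%:E * \int[power_probability P r]_y (F y ^+ 2)%:E +
   (K * (4 * 80 * ell * N%:R^-1))%:E *
     \int[Pr]_w (max_selected_at F (selection_at Z w) (sample X w) ^+ 2)%:E)%E.
Proof.
have p01 := sampling_prob01 R N0.
set p := sampling_prob R n r N in p01.
have ell0 : 0 <= ell by rewrite /ell ln_ge0// ler1n muln_gt0.
have K0 : 0 <= K by do 2 (apply: mulr_ge0 => //); [rewrite mulr_ge0|exact: sqr_ge0].
have K1 : 0 <= K * (4 * 80 * ell * N%:R^-1) by rewrite mulr_ge0// mulr_ge0 ?invr_ge0// mulr_ge0.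
have mD := measurable_sample X.
have mH1 (z : {ffun 'I_M * I -> bool}) :
    measurable_fun setT (fun w => max_sup_norm_sqr N FF z (sample X w)).
  exact: (measurableT_comp (measurable_max_sup_norm_sqr z) mD).
have mtop2 (z : {ffun 'I_M * I -> bool}) :
    measurable_fun setT (fun x : n.-tuple S => (max_selected_at F z x ^+ 2)%:E : \bar R).
  by apply/measurable_EFinP; apply: measurable_funX; exact: measurable_max_selected.
have top20 (z : {ffun 'I_M * I -> bool}) (x : n.-tuple S) : (0 <= (max_selected_at F z x ^+ 2)%:E)%E.
  by rewrite lee_fin sqr_ge0.
have mH2 (z : {ffun 'I_M * I -> bool}) :
    measurable_fun setT (fun w => (max_selected_at F z (sample X w) ^+ 2)%:E : \bar R).
  exact: (measurableT_comp (mtop2 z) mD).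
have mF2 : measurable_fun setT (fun y => F y ^+ 2) by exact: measurable_funX.
have mS t : measurable_fun setT (fun w => (F (subsample (sample X w) t) ^+ 2)%:E : \bar R).
  apply/measurable_EFinP.
  exact: (measurableT_comp mF2 (measurableT_comp (measurable_subsample t) mD)).
have bw0 z : (0 <= (bern_weight p z)%:E)%E by rewrite lee_fin bern_weight_ge0.
rewrite (@integral_selection _ _ _ _ _ _ _ _ X Z p p01 Z_law Z_indep XZ_indep
  (max_sup_norm_sqr N FF) measurable_max_sup_norm_sqr max_sup_norm_sqr_ge0).
rewrite (@integral_selection _ _ _ _ _ _ _ _ X Z p p01 Z_law Z_indep XZ_indep
  (fun z x => (max_selected_at F z x ^+ 2)%:E) mtop2 top20).
have pull (H : {ffun 'I_M * I -> bool} -> Omega -> \bar R) :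
    (forall z, measurable_fun setT (H z)) -> (forall z w, (0 <= H z w)%E) ->
    (\sum_z (bern_weight p z)%:E * \int[Pr]_w H z w =
     \int[Pr]_w \sum_z (bern_weight p z)%:E * H z w)%E.
  move=> mH H0; rewrite ge0_integral_sum//.
  - by apply: eq_bigr => z _; rewrite ge0_integralZl_EFin// bern_weight_ge0.
  - by move=> z; apply: measurable_funeM.
  - by move=> z w _; rewrite mule_ge0.
have msum (H : {ffun 'I_M * I -> bool} -> Omega -> \bar R) :
    (forall z, measurable_fun setT (H z)) ->
    measurable_fun setT (fun w => \sum_z (bern_weight p z)%:E * H z w)%E.
  by move=> mH; apply: emeasurable_sum => z; apply: measurable_funeM.
rewrite (pull _ mH1 (fun z w => max_sup_norm_sqr_ge0 z (sample X w))).
rewrite (pull _ mH2 (fun z w => top20 z (sample X w))).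
have mS2 : measurable_fun setT (fun w => (K * (2 * (#|I|%:R^-1 *
    \sum_(t : I) F (subsample (sample X w) t) ^+ 2)))%:E : \bar R).
  apply/measurable_EFinP.
  have mc (a : R) : measurable_fun [set: Omega] (fun=> a) by exact: measurable_cst.
  apply: (measurable_funM (mc _)); apply: (measurable_funM (mc _)).
  apply: (measurable_funM (mc _)).
  by apply: measurable_sum => t; apply/measurable_EFinP; exact: mS.
have S20 w : (0 <= (K * (2 * (#|I|%:R^-1 *
    \sum_(t : I) F (subsample (sample X w) t) ^+ 2)))%:E)%E.
  rewrite lee_fin mulr_ge0// mulr_ge0// mulr_ge0 ?invr_ge0//.
  by rewrite sumr_ge0// => t _; exact: sqr_ge0.
apply: (@le_trans _ _ (\int[Pr]_w (
   (K * (2 * (#|I|%:R^-1 * \sum_(t : I) F (subsample (sample X w) t) ^+ 2)))%:E +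
   (K * (4 * 80 * ell * N%:R^-1))%:E *
     \sum_(z : {ffun 'I_M * I -> bool})
       (bern_weight p z)%:E * (max_selected_at F z (sample X w) ^+ 2)%:E))%E).
  apply: ge0_le_integral => //.
  - by move=> w _; rewrite sume_ge0// => z _; rewrite mule_ge0// max_sup_norm_sqr_ge0.
  - exact: msum.
  - by apply: emeasurable_funD => //; apply: measurable_funeM; exact: msum.
  - by move=> w _; apply: conditional_mean_bound.
have B0 w : (0 <= \sum_(z : {ffun 'I_M * I -> bool})
    (bern_weight p z)%:E * (max_selected_at F z (sample X w) ^+ 2)%:E)%E.
  by apply: sume_ge0 => z _; apply: mule_ge0; [exact: bw0|exact: top20].
rewrite ge0_integralD//; first last.
- by apply: measurable_funeM; exact: msum.
- by move=> w _; apply: mule_ge0; [rewrite lee_fin|exact: B0].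
rewrite (ge0_integralZl_EFin _ _ _ _ K1)//; last exact: msum.
apply: leeD => //.
rewrite (eq_integral (fun w => (K * 2 * #|I|%:R^-1)%:E *
    \sum_(t : I) (F (subsample (sample X w) t) ^+ 2)%:E)%E); last first.
  by move=> w _; rewrite sumEFin -EFinM !mulrA.
have c0 : 0 <= K * 2 * #|I|%:R^-1 by rewrite mulr_ge0 ?invr_ge0// mulr_ge0.
have F20 t w : (0 <= (F (subsample (sample X w) t) ^+ 2)%:E)%E by rewrite lee_fin sqr_ge0.
rewrite (ge0_integralZl_EFin _ _ _ _ c0)//; last 2 first.
- by move=> w _; rewrite sume_ge0.
- by apply: emeasurable_sum.
rewrite ge0_integral_sum//.
under eq_bigr => t _ do rewrite (integral_subsample t mF2 (fun y => sqr_ge0 _)).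
have I0 : #|I|%:R != 0 :> R.
  by rewrite pnatr_eq0 -lt0n; case/andP: N0 => N1; exact: leq_trans.
rewrite (eq_bigr (fun=> 1%:E * \int[power_probability P r]_y (F y ^+ 2)%:E)%E); last first.
  by move=> t _; rewrite mul1e.
rewrite -ge0_sume_distrl// sumEFin sumr_const muleA -EFinM.
by rewrite mulfVK// [K * 2]mulrC.
Qed.

End integrated_bound.

Theorem lemmaA8 (R : realType) :
  exists C : R, 0 < C /\
  forall (r n M N : nat) (hr : (2 <= r)%N) (hM : (1 <= M)%N)
    (hN : (0 < N <= #|index_set n r|)%N)
    (d : measure_display) (S : measurableType d) (P : probability S R)
    (dO : measure_display) (Omega : measurableType dO)
    (Pr : probability Omega R)
    (X : 'I_n -> {RV Pr >-> S})
    (X_law : forall i A, measurable A -> distribution Pr (X i) A = P A)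
    (X_indep : mutually_independent X)
    (Z : 'I_M * index_set n r -> {RV Pr >-> bool})
    (Z_law : forall j A,
       distribution Pr (Z j) A = bernoulli_prob (sampling_prob R n r N) A)
    (Z_indep : mutually_independent Z)
    (XZ_indep : independent_families X Z)
    (FF : set (r.-tuple S -> R))
    (FF_sym : forall f, FF f -> symmetric_fun f)
    (FF_meas : forall f, FF f -> measurable_fun setT f)
    (FF_sup : measurable_sup n N FF)
    (F : r.-tuple S -> R)
    (F_ge0 : forall x, 0 <= F x)
    (F_meas : measurable_fun setT F)
    (F_env : forall f x, FF f -> `|f x| <= F x)
    (F_L2 : (0 < \int[power_probability P r]_x (F x ^+ 2)%:E < +oo)%E),
  let data := fun omega => [tuple X i omega | i < n] in
  let sel := fun omega m t => Z (m, t) omega in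
  let D := fun m omega => selection_process N (data omega) (sel omega m) in
  let T := fun omega => max_selected F (data omega) (sel omega) in
  (\int[Pr]_omega \big[maxe/0]_(m < M) (sup_norm FF (D m omega) ^+ 2) <=
   C%:E * entropy_integral FF F 1 ^+ 2 *
   ((ln (2 * M)%:R)%:E * L2 (power_probability P r) F ^+ 2 +
    (ln (2 * M)%:R ^+ 2)%:E * L2 Pr T ^+ 2 * (N%:R^-1)%:E))%E.

Proof.
exists (4 * (80 * 81 * 4) * (4 * 80)); split; first by rewrite !mulr_gt0.
move=> r n M N _ hM hN ? S P ? Omega Pr X X_law X_indep Z Z_law Z_indep XZ_indep
  FF _ FF_meas FF_sup F F_ge0 F_meas F_env /andP[F_gt0 _].
lazy zeta.
set C : R := 4 * _ * _.
have C0 : 0 < C by rewrite !mulr_gt0.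
set ell := ln (2 * M)%:R.
have ell0 : 0 < ell by apply: lt_le_trans (ln_double_ge hM); lra.
have J0 : (0 <= entropy_integral FF F 1)%E.
  by apply: integral_ge0 => x _; exact: sqrte_ge0.
rewrite !L2_sqr.
set a := (\int[power_probability P r]_x _)%E; set b := (X in (_ * X * (N%:R^-1)%:E)%E).
have b0 : (0 <= b)%E by apply: integral_ge0 => x _; rewrite lee_fin sqr_ge0.
have rhs0 : (0 < ell%:E * a + (ell ^+ 2)%:E * b * (N%:R^-1)%:E)%E.
  apply: (@lt_le_trans _ _ (ell%:E * a)%E); first exact: mule_gt0.
  by rewrite leeDl// mule_ge0 ?lee_fin ?invr_ge0// mule_ge0 ?lee_fin ?sqr_ge0.
(* For an empty class the left-hand side is 0. *)
have [FF0|FF0] := eqVneq FF set0.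
  rewrite [leLHS](_ : _ = 0%E).
    by apply: mule_ge0 (ltW rhs0); rewrite mule_ge0 ?lee_fin ?(ltW C0)// expe2 mule_ge0.
  apply: integral0_eq => w _; apply: bigmax_eq_id => m _.
  by rewrite /sup_norm FF0 image_set0 setU0 ereal_sup1 expe2 mul0e.
(* If the entropy integral is infinite, so is the right-hand side, since
   [P^r F^2 > 0]. *)
have [Jy|Jy] := eqVneq (entropy_integral FF F 1) +oo%E.
  by rewrite Jy expe2 mulyy gt0_muley ?lte_fin// gt0_mulye// leey.
have Jlt : (entropy_integral FF F 1 < +oo)%E by rewrite ltNge leye_eq.
have JE : entropy_integral FF F 1 = (fine (entropy_integral FF F 1))%:E.
  by rewrite fineK// ge0_fin_numE.
set J := fine _ in JE.
have FFne : FF !=set0 by exact/set0P.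
have := integrated_bound X_law X_indep Z_law Z_indep XZ_indep
  FFne FF_meas FF_sup F_meas F_env hM hN JE.
rewrite -/ell -/a JE.
have -> : (\int[Pr]_w (max_selected_at F (selection_at Z w) (sample X w) ^+ 2)%:E = b)%E.
  apply: eq_integral => w _; congr (_ ^+ 2)%:E; congr (max_selected F _ _).
  by apply/funext => m; apply/funext => t; rewrite ffunE.
have -> : (\int[Pr]_w max_sup_norm_sqr N FF (selection_at Z w) (sample X w) =
   \int[Pr]_w \big[maxe/0]_(m < M) (sup_norm FF
     (selection_process N [tuple X i w | i < n] (fun t => Z (m, t) w)) ^+ 2))%E.
  apply: eq_integral => w _; apply: eq_bigr => m _; congr (sup_norm FF _ ^+ 2)%E.
  by congr (selection_process N _ _); apply/funext => t; rewrite ffunE.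
move=> /le_trans; apply.
have a0 : (0 <= a)%E by exact: ltW.
have N0 : 0 <= N%:R^-1 :> R by rewrite invr_ge0.
have ellJ : 0 <= ell * J ^+ 2 by rewrite mulr_ge0 ?sqr_ge0// ltW.
have ella : (0 <= ell%:E * a)%E by apply: mule_ge0 => //; rewrite lee_fin ltW.
have ellb : (0 <= (ell ^+ 2)%:E * b * (N%:R^-1)%:E)%E.
  by apply: mule_ge0; [apply: mule_ge0|]; rewrite ?lee_fin ?sqr_ge0.
(* The two terms are compared separately; only the first leaves some slack. *)
clearbody a b; rewrite expe2 -!EFinM ge0_muleDr//.
rewrite [((ell ^+ 2)%:E * b * _)%E]muleAC !muleA -!EFinM.
apply: leeD; apply: lee_wpmul2r => //; rewrite lee_fin /C.
  nra.
rewrite le_eqVlt; apply/orP; left; apply/eqP; ring.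
Qed.
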